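(* Assume $\Sigma_w\succ0$, $W^{(1)}\succ0$, $W^{(2)}\succ0$, $\Sigma_0\succ0$ and $\beta>b_0:=\min_{\pi\in\Pi}\operatorname{Tr}(W^{(2)}\Sigma^{\pi})$. Let $\mu=\lambda_{\min}(W^{(2)})$, let $\delta\ge0$, and let $\Sigma^\star$ be the (unique) minimizer of $f(\Sigma)=\operatorname{Tr}\big(W^{(1)}(\Sigma_0+\Sigma)^{-1}\big)$ over $\mathcal{D}$. Let $\Sigma^{(0)}\in\mathcal{D}$ be arbitrary and let $\{\Sigma^{(i)}\}_{i\ge0}$ be generated by $$\Sigma^{(i+1)}=(1-\alpha_i)\Sigma^{(i)}+\alpha_iS^{(i)},\qquad \alpha_i=\frac{2}{i+2},$$ where for each $i$ the matrix $S^{(i)}\in\mathcal{D}$ satisfies, with $M^{(i)}=\nabla f(\Sigma^{(i)})$, $$\operatorname{Tr}(M^{(i)}S^{(i)})\le\min_{\Sigma\in\mathcal{D}}\operatorname{Tr}(M^{(i)}\Sigma)+\delta .$$ Then for all $M\ge1$, $$f(\Sigma^{(M)})-f(\Sigma^\star)\le\frac{2C_f}{M+2}+\delta,\qquad C_f\le\frac{8\,\|W^{(1)}\|_2\,\beta^2}{\lambda_{\min}^3(\Sigma_0)\,\mu^2},$$ where $C_f$ is the curvature constant of $f$ over $\mathcal{D}$. Moreover, $$\|\Sigma^{(M)}-\Sigma^\star\|_F\le\sqrt{\frac{2}{m_f}\Big(\frac{2C_f}{M+2}+\delta\Big)},\qquad m_f=\frac{2\lambda_{\min}(W^{(1)})}{\big(\lambda_{\max}(\Sigma_0)+\beta/\mu\big)^3}.$$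 In particular, with $\delta=0$ the objective values converge at rate $\mathcal{O}(1/M)$ and the iterates at rate $\mathcal{O}(1/\sqrt{M})$.
   Context: Setting. Consider $x_{t+1}=Ax_t+Bu_t+w_t$, $x_0=0$, $t=0,\dots,H-1$, with $H$ a positive integer, $x_t\in\mathbb{R}^n$, $u_t\in\mathbb{R}^m$, $A\in\mathbb{R}^{n\times n}$, $B\in\mathbb{R}^{n\times m}$. The disturbances $w_t$ are i.i.d., zero mean, with covariance $\Sigma_w\succ0$. $\Pi$ is the set of causal, possibly randomized policies $\pi$: $u_t\sim\pi_t(x_0,\dots,x_t)$, where the internal randomization is independent of future disturbances $w_t,w_{t+1},\dots$; only policies for which the covariance below is finite are considered. Put $z_t=[x_t^\top\ u_t^\top]^\top\in\mathbb{R}^d$, $d=n+m$, and $$\Sigma^{\pi}=\mathbb{E}^{\pi}\Big[\sum_{t=0}^{H-1}z_tz_t^\top\Big]\succeq0 .$$ Let $\mathcal{C}=\{\Sigma^{\pi}:\pi\in\Pi\}$ and $\mathcal{D}=\{\Sigma\in\mathcal{C}:\operatorname{Tr}(W^{(2)}\Sigma)\le\beta\}$. The matrices $W^{(1)},W^{(2)},\Sigma_0$ are symmetric $d\times d$ and $\beta>0$. The gradient is with respect to the trace inner product on symmetric matrices: $\nabla f(\Sigma)=-(\Sigma_0+\Sigma)^{-1}W^{(1)}(\Sigma_0+\Sigma)^{-1}$. The curvature constant is $$C_f=\sup_{\Sigma,S\in\mathcal{D},\ \gamma\in(0,1]}\frac{2}{\gamma^2}\Big[f(\Sigma+\gamma(S-\Sigma))-f(\Sigma)-\gamma\langle\nabla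 f(\Sigma),S-\Sigma\rangle\Big],\qquad \langle X,Y\rangle=\operatorname{Tr}(X^\top Y).$$ $\|\cdot\|_2$ is the spectral norm and $\|\cdot\|_F$ the Frobenius norm. The strong convexity constant is denoted $m_f$ to distinguish it from the input dimension $m$. *)

(* Defs.v *)
From HB Require Import structures.
From mathcomp Require Import all_boot all_order all_algebra.
From mathcomp Require Import all_classical all_reals all_analysis.

Set Implicit Arguments.
Unset Strict Implicit.
Unset Printing Implicit Defensive.

Import Order.TTheory GRing.Theory Num.Theory.
Import numFieldNormedType.Exports.
Local Open Scope classical_set_scope.
Local Open Scope ring_scope.

Section MatrixNotions.
Context {R : realType}.

Definition posdef k (M : 'M[R]_k) : Prop :=
  M^T = M /\ forall x : 'cV[R]_k, x != 0 -> 0 < \tr (x^T *m M *m x).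

(* Meant for symmetric matrices of positive size, whose spectrum is finite and
   nonempty: the infimum and the supremum are then attained. *)
Definition lambda_min k (M : 'M[R]_k) : R := inf [set a | eigenvalue M a].
Definition lambda_max k (M : 'M[R]_k) : R := sup [set a | eigenvalue M a].

(* On column vectors this is the Euclidean norm. *)
Definition frobenius k l (X : 'M[R]_(k, l)) : R := Num.sqrt (\tr (X^T *m X)).

Definition spectral_norm k (M : 'M[R]_k) : R :=
  sup [set frobenius (M *m x) | x in [set x : 'cV[R]_k | frobenius x = 1]].

End MatrixNotions.

(* Column vectors with the product (= Borel) sigma-algebra; the carrier of
   [vec R k] is ['cV[R]_k]. *)
Definition cylinders (R : realType) (k : nat) : set (set 'cV[R]_k) :=
  [set A | exists (i : 'I_k) (B : set R),
      measurable B /\ A = [set x : 'cV[R]_k | B (x i 0)]].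
Notation vec R k := (g_sigma_algebraType (@cylinders R k)).

Definition events_of {T : Type} {d} {V : measurableType d} (X : T -> V) :
  set (set T) := [set X @^-1` A | A in measurable].

Definition indep_systems {R : realType} {d} {T : measurableType d}
    (P : probability T R) (G1 G2 : set (set T)) : Prop :=
  forall E F, <<s G1 >> E -> <<s G2 >> F -> P (E `&` F) = (P E * P F)%E.

Section Disturbances.
Context {R : realType} {n : nat} {d : measure_display} {Omega : measurableType d}.
Variables (P : probability Omega R) (H : nat) (w : nat -> Omega -> vec R n).

(* The product rule for proper subfamilies is the case [A t = setT]. *)
Definition iid : Prop :=
  [/\ forall t, (t < H)%N -> measurable_fun setT (w t),
      forall s t, (s < H)%N -> (t < H)%N ->
        forall A, measurable A -> P (w s @^-1` A) = P (w t @^-1` A)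
    & forall A : nat -> set (vec R n), (forall t, measurable (A t)) ->
        P (\bigcap_(t in [set t | (t < H)%N]) (w t @^-1` A t)) =
        (\prod_(t < H) fine (P (w t @^-1` A t)))%:E].

Definition zero_mean_cov (Sigma_w : 'M[R]_n) : Prop :=
  forall t, (t < H)%N ->
    (forall i, ('E_P[fun om => (w t om : 'cV[R]_n) i 0%R] = 0)%E) /\
    (forall i j, covariance P (fun om => (w t om : 'cV[R]_n) i 0)
                              (fun om => (w t om : 'cV[R]_n) j 0)
                 = (Sigma_w i j)%:E).

End Disturbances.

(* A causal randomized policy together with the closed loop that it generates.
   Its probability space extends the one carrying the disturbances, so as to
   accommodate the internal randomization [cl_seed].  The input at time t is a
   function of x_0, ..., x_t and of the internal randomization at time t.  The
   internal randomization up to time t may be correlated across time, but it is,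
   jointly with the past disturbances, independent of w_t, ..., w_(H-1). *)
Record closed_loop (R : realType) (n m : nat) (A : 'M[R]_n) (B : 'M[R]_(n, m))
    (H : nat) (d : measure_display) (Omega : measurableType d)
    (P : probability Omega R) (w : nat -> Omega -> vec R n) := ClosedLoop {
  cl_disp : measure_display;
  cl_space : measurableType cl_disp;
  cl_prob : probability cl_space R;
  cl_base : cl_space -> Omega;
  cl_base_meas : measurable_fun setT cl_base;
  cl_base_law : forall E, measurable E -> cl_prob (cl_base @^-1` E) = P E;

  cl_seed_disp : measure_display;
  cl_seed_space : measurableType cl_seed_disp;
  cl_seed : nat -> cl_space -> cl_seed_space;
  cl_seed_meas : forall t, measurable_fun setT (cl_seed t);
  cl_seed_indep : forall t, (t < H)%N ->
    indep_systems cl_prob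
      (\bigcup_(s in [set s | (s < t)%N]) events_of (w s \o cl_base) `|`
       \bigcup_(s in [set s | (s <= t)%N]) events_of (cl_seed s))
      (\bigcup_(s in [set s | (t <= s < H)%N]) events_of (w s \o cl_base));

  cl_rule : forall t : nat, t.+1.-tuple (vec R n) * cl_seed_space -> vec R m;
  cl_rule_meas : forall t, measurable_fun setT (@cl_rule t);

  cl_state : nat -> cl_space -> vec R n;
  cl_input : nat -> cl_space -> vec R m;
  cl_init : forall om, cl_state 0 om = 0 :> 'cV[R]_n;
  cl_dynamics : forall t om, (t < H)%N ->
    cl_state t.+1 om = A *m (cl_state t om : 'cV[R]_n)
      + B *m (cl_input t om : 'cV[R]_m) + w t (cl_base om) :> 'cV[R]_n;
  cl_control : forall t om, (t < H)%N ->
    cl_input t om = cl_rule ([tuple cl_state s om | s < t.+1], cl_seed t om)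
}.

Section Covariances.
Context {R : realType} {n m : nat} {A : 'M[R]_n} {B : 'M[R]_(n, m)} {H : nat}
  {d : measure_display} {Omega : measurableType d} {P : probability Omega R}
  {w : nat -> Omega -> vec R n}.
Implicit Type pi : closed_loop A B H P w.

Definition cl_z pi (t : nat) (om : cl_space pi) : 'cV[R]_(n + m) :=
  col_mx (cl_state t om : 'cV[R]_n) (cl_input t om : 'cV[R]_m).

Definition cl_gram pi (om : cl_space pi) : 'M[R]_(n + m) :=
  \sum_(t < H) cl_z t om *m (cl_z t om)^T.

Definition finite_covariance pi : Prop :=
  forall i j, (cl_prob pi).-integrable setT (fun om => (@cl_gram pi om i j)%:E).

Definition covariance_of pi : 'M[R]_(n + m) :=
  \matrix_(i, j) fine ('E_(cl_prob pi)[fun om => @cl_gram pi om i j])%E.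

End Covariances.

Section Sets.
Context {R : realType} {n m : nat}.
Variables (A : 'M[R]_n) (B : 'M[R]_(n, m)) (H : nat)
  (d : measure_display) (Omega : measurableType d) (P : probability Omega R)
  (w : nat -> Omega -> vec R n).

Definition attainable : set 'M[R]_(n + m) :=
  [set S | exists2 pi : closed_loop A B H P w,
      finite_covariance pi & S = covariance_of pi].

Definition budgeted (W2 : 'M[R]_(n + m)) (beta : R) : set 'M[R]_(n + m) :=
  [set S | attainable S /\ \tr (W2 *m S) <= beta].

End Sets.

Section Objective.
Context {R : realType} {k : nat}.

Definition objective (W1 S0 S : 'M[R]_k) : R := \tr (W1 *m invmx (S0 + S)).

Definition objective_grad (W1 S0 S : 'M[R]_k) : 'M[R]_k :=
  - (invmx (S0 + S) *m W1 *m invmx (S0 + S)).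

Definition is_minimizer (D : set 'M[R]_k) (f : 'M[R]_k -> R) (S : 'M[R]_k) :=
  D S /\ forall X, D X -> f S <= f X.

Definition curvature_constant (D : set 'M[R]_k) (f : 'M[R]_k -> R)
    (gradf : 'M[R]_k -> 'M[R]_k) : \bar R :=
  ereal_sup [set r : \bar R | exists (X S : 'M[R]_k) (gamma : R),
    [/\ D X, D S, 0 < gamma <= 1
      & r = (2 / gamma ^+ 2 *
             (f (X + gamma *: (S - X)) - f X
              - gamma * \tr ((gradf X)^T *m (S - X))))%:E]].

End Objective.

(* Main.v *)
Require Import Defs.
From HB Require Import structures.
From mathcomp Require Import all_boot all_order all_algebra.
From mathcomp Require Import all_classical all_reals all_analysis.
From mathcomp Require Import measurable_realfun ring lra.

Set Implicit Arguments.
Unset Strict Implicit.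
Unset Printing Implicit Defensive.

Import Order.TTheory GRing.Theory Num.Theory.
Import numFieldNormedType.Exports.
Local Open Scope classical_set_scope.
Local Open Scope ring_scope.

(** The theorem combines the Frank-Wolfe rate with two-sided curvature bounds
    for f(S) = Tr(W1 (S0 + S)^-1) on the budgeted set D, a convex set of positive
    semidefinite matrices with traces at most beta / mu.

    Curvature.  No calculus is involved: with P = S0 + X, Q = S0 + Y and
    E = Y - X, the resolvent identity applied twice gives the exact formula
      Q^-1 = P^-1 - P^-1 E P^-1 + P^-1 E Q^-1 E P^-1,
    so the first-order remainder of f is Tr(W1 P^-1 E Q^-1 E P^-1)
    ([objective_remainder]).  Since Tr(M N) >= 0 for positive semidefinite M and
    N ([psd_tr_mul_ge0]), each factor of that product can be replaced by a scalar
    bound on its spectrum.  Lower bounds on P and Q bound the remainder above by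
    ||W1|| / lambda_min(S0)^3 times ||E||_F^2, hence the bound on C_f; upper
    bounds on P and Q bound it below by (m_f / 2) ||E||_F^2, which is strong
    convexity.

    Rate.  Convexity of f, the definition of C_f and the inexact oracle give
      h_(i+1) <= (1 - a_i) h_i + a_i^2 C_f / 2 + a_i delta
    for the gap h_i = f(Sigma_i) - f(Sigma_star), and with a_i = 2 / (i + 2) this
    recursion solves to h_M <= 2 C_f / (M + 2) + delta ([frank_wolfe_recursion]).
    Strong convexity and the first-order condition at the minimizer turn the gap
    into a distance ([minimizer_growth]); the same inequality yields uniqueness.

    Convexity of D.  The iterates stay in D, and segments issued from the
    minimizer too, because a mixture of two policies is a policy.  Tossing a coin
    once and for all to choose between two closed loops amounts to running both on
    the disjoint union of their probability spaces, weighted by 1 - t and t.  The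
    randomization of the mixture, which records the outcome of the coin, remains
    independent of the future disturbances since these have the same law in both
    loops ([mix_seed_indep]), and covariances are integrals, hence affine in the
    mixed law ([covariance_of_mix]).

    Eigenvalues.  The extreme eigenvalues are reached without compactness or the
    spectral theorem: if t is the largest real such that M - t I is positive
    semidefinite, then M - t I is singular, for an invertible positive
    semidefinite matrix dominates a positive multiple of I
    ([psd_unit_coercive]). *)

(** * Positive semidefinite matrices *)

Section PositiveSemidefinite.
Context {R : realType}.
Implicit Types (k l : nat).

Definition psd k (M : 'M[R]_k) : Prop :=
  M^T = M /\ forall x : 'cV[R]_k, 0 <= \tr (x^T *m M *m x).

Lemma posdef_psd k (M : 'M[R]_k) : posdef M -> psd M.
Proof.
move=> [Ms Mp]; split=> // x; have [->|/Mp/ltW//] := eqVneq x 0.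
by rewrite mulmx0 mxtrace0.
Qed.

Lemma tr_gramE k l (X : 'M[R]_(k, l)) : \tr (X^T *m X) = \sum_i \sum_j X i j ^+ 2.
Proof.
rewrite exchange_big; apply: eq_bigr => j _; rewrite !mxE.
by apply: eq_bigr => i _; rewrite !mxE expr2.
Qed.

Lemma tr_gram_ge0 k l (X : 'M[R]_(k, l)) : 0 <= \tr (X^T *m X).
Proof.
by rewrite tr_gramE; apply: sumr_ge0 => i _; apply: sumr_ge0 => j _; rewrite sqr_ge0.
Qed.

Lemma tr_gram_eq0 k l (X : 'M[R]_(k, l)) : (\tr (X^T *m X) == 0) = (X == 0).
Proof.
apply/idP/eqP => [|->]; last by rewrite mulmx0 mxtrace0.
rewrite tr_gramE psumr_eq0; last by move=> i _; apply: sumr_ge0 => j _; rewrite sqr_ge0.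
move=> /allP X0; apply/matrixP => i j; rewrite mxE.
have := X0 i (mem_index_enum i); rewrite psumr_eq0; last by move=> ? _; rewrite sqr_ge0.
by move=> /allP /(_ j (mem_index_enum j)) /=; rewrite sqrf_eq0 => /eqP.
Qed.

Lemma tr_gram_gt0 k l (X : 'M[R]_(k, l)) : (0 < \tr (X^T *m X)) = (X != 0).
Proof. by rewrite lt_def tr_gram_ge0 andbT tr_gram_eq0. Qed.

Lemma mx11_tr (X : 'M[R]_1) : X = (\tr X)%:M.
Proof. by rewrite trace_mx11 -mx11_scalar. Qed.

Lemma tr_mul11 (X Y : 'M[R]_1) : \tr (X *m Y) = \tr X * \tr Y.
Proof. by rewrite [X in X *m _]mx11_tr mul_scalar_mx mxtraceZ. Qed.

Lemma tr_mulT k (x y : 'cV[R]_k) : \tr (y^T *m x) = \tr (x^T *m y).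
Proof. by rewrite -mxtrace_tr trmx_mul trmxK. Qed.

Lemma tr_form_sym k (M : 'M[R]_k) (x y : 'cV[R]_k) :
  M^T = M -> \tr (y^T *m M *m x) = \tr (x^T *m M *m y).
Proof. by move=> Ms; rewrite -mxtrace_tr !trmx_mul trmxK Ms mulmxA. Qed.

Lemma tr_formD k (M : 'M[R]_k) (s t : R) (x y : 'cV[R]_k) : M^T = M ->
  \tr ((s *: x + t *: y)^T *m M *m (s *: x + t *: y)) =
  s ^+ 2 * \tr (x^T *m M *m x) + 2 * (s * t) * \tr (x^T *m M *m y)
    + t ^+ 2 * \tr (y^T *m M *m y).
Proof.
move=> Ms; have -> : (s *: x + t *: y)^T = s *: x^T + t *: y^T by rewrite linearD !linearZ.
rewrite !(mulmxDl, mulmxDr) -!scalemxAl -!scalemxAr.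
rewrite !mxtraceD !mxtraceZ (tr_form_sym x y Ms); ring.
Qed.

Lemma tr_formZ k l (M : 'M[R]_k) (a : R) (x : 'M[R]_(k, l)) :
  \tr ((a *: x)^T *m M *m (a *: x)) = a ^+ 2 * \tr (x^T *m M *m x).
Proof.
have -> : (a *: x)^T = a *: x^T by rewrite linearZ.
by rewrite -!scalemxAl -scalemxAr !mxtraceZ mulrA -expr2.
Qed.

Lemma tr_gramZ k l (a : R) (X : 'M[R]_(k, l)) :
  \tr ((a *: X)^T *m (a *: X)) = a ^+ 2 * \tr (X^T *m X).
Proof. by have := tr_formZ 1%:M a X; rewrite !mulmx1. Qed.

(** The discriminant argument for the form of [M], which may be degenerate: the
    quadratic in the scalars s, t is nonnegative everywhere. *)
Lemma psd_cauchy k (M : 'M[R]_k) (x y : 'cV[R]_k) : psd M ->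
  \tr (x^T *m M *m y) ^+ 2 <= \tr (x^T *m M *m x) * \tr (y^T *m M *m y).
Proof.
move=> [Ms Mp].
have := fun s t => Mp (s *: x + t *: y).
have := Mp x; have := Mp y.
set a := \tr (x^T *m M *m x); set b := \tr (x^T *m M *m y).
set c := \tr (y^T *m M *m y) => c0 a0 Mq.
have {Mq}q s t : 0 <= s ^+ 2 * a + 2 * (s * t) * b + t ^+ 2 * c.
  by rewrite -tr_formD.
move: a b c c0 a0 q => a b c c0 a0 q.
have [c1|] := ltrP 0 c.
  (* t / s = - b / c minimizes the form of x + (t / s) y. *)
  have := q c (- b) => {}q.
  have : 0 <= c * (a * c - b ^+ 2) by lra.
  by rewrite pmulr_rge0// subr_ge0.
move=> c1; have {c1 c0}c0 : c = 0 by lra.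
move: q; rewrite {}c0 => q.
have [->|b0] := eqVneq b 0; first by rewrite expr0n mulr0.
(* The form is affine in t; this t makes it equal to - 1. *)
have {q}:= q 1 (- (a + 1) / (2 * b)).
have -> : 2 * (1 * (- (a + 1) / (2 * b))) * b = - (a + 1) by field.
by rewrite expr1n mul1r mulr0 addr0; lra.
Qed.

Lemma psd_ker k (M : 'M[R]_k) (x : 'cV[R]_k) :
  psd M -> \tr (x^T *m M *m x) = 0 -> M *m x = 0.
Proof.
move=> Mp x0; have := psd_cauchy (M *m x) x Mp; rewrite x0 mulr0.
have -> : (M *m x)^T *m M *m x = (M *m x)^T *m (M *m x) by rewrite mulmxA.
by rewrite real_exprn_even_le0 ?num_real//= => /eqP/eqP; rewrite tr_gram_eq0 => /eqP.
Qed.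

Lemma psd_tr_congr k l (M : 'M[R]_k) (Y : 'M[R]_(k, l)) :
  psd M -> 0 <= \tr (Y^T *m M *m Y).
Proof.
move=> [_ Mp]; apply: sumr_ge0 => j _.
suff -> : (Y^T *m M *m Y) j j = \tr ((col j Y)^T *m M *m col j Y) by [].
by rewrite trace_mx11 tr_col -row_mul colE mulmxA -colE -row_mul !mxE.
Qed.

Lemma psd_congr k l (M : 'M[R]_k) (Y : 'M[R]_(k, l)) : psd M -> psd (Y^T *m M *m Y).
Proof.
move=> [Ms Mp]; split=> [|x]; first by rewrite !trmx_mul trmxK Ms mulmxA.
by have := Mp (Y *m x); rewrite trmx_mul !mulmxA.
Qed.

Lemma psdD k (M N : 'M[R]_k) : psd M -> psd N -> psd (M + N).
Proof.
move=> [Ms Mp] [Ns Np]; split=> [|x]; first by rewrite linearD /= Ms Ns.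
by rewrite mulmxDr mulmxDl mxtraceD addr_ge0.
Qed.

Lemma tr_form_scalar k l (a : R) (x : 'M[R]_(k, l)) :
  \tr (x^T *m a%:M *m x) = a * \tr (x^T *m x).
Proof. by rewrite mul_mx_scalar -scalemxAl mxtraceZ. Qed.

(** Bounds on the spectrum of a symmetric matrix are carried throughout as
    positive semidefiniteness of [M - a%:M] or [a%:M - M]; these two lemmas
    translate them into inequalities between quadratic forms. *)
Lemma psd_subscalarP k (M : 'M[R]_k) (a : R) :
  psd (M - a%:M) <->
  M^T = M /\ forall x : 'cV[R]_k, a * \tr (x^T *m x) <= \tr (x^T *m M *m x).
Proof.
have E x : \tr (x^T *m (M - a%:M) *m x) = \tr (x^T *m M *m x) - a * \tr (x^T *m x).
  by rewrite mulmxBr mulmxBl raddfB /= tr_form_scalar.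
have T : (M - a%:M)^T = M^T - a%:M by rewrite raddfB /= tr_scalar_mx.
split=> -[Ms Mp]; split.
- by apply: (addIr (- a%:M)); rewrite -T.
- by move=> x; have := Mp x; rewrite E subr_ge0.
- by rewrite T Ms.
- by move=> x; rewrite E subr_ge0.
Qed.

Lemma psd_scalarBP k (M : 'M[R]_k) (a : R) :
  psd (a%:M - M) <->
  M^T = M /\ forall x : 'cV[R]_k, \tr (x^T *m M *m x) <= a * \tr (x^T *m x).
Proof.
have E x : \tr (x^T *m (a%:M - M) *m x) = a * \tr (x^T *m x) - \tr (x^T *m M *m x).
  by rewrite mulmxBr mulmxBl raddfB /= tr_form_scalar.
have T : (a%:M - M)^T = a%:M - M^T by rewrite raddfB /= tr_scalar_mx.
split=> -[Ms Mp]; split.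
- by apply/oppr_inj/(addrI a%:M); rewrite -T.
- by move=> x; have := Mp x; rewrite E subr_ge0.
- by rewrite T Ms.
- by move=> x; rewrite E subr_ge0.
Qed.

Lemma psd_scalar k (a : R) : 0 <= a -> psd (a%:M : 'M[R]_k).
Proof.
move=> a0; split=> [|x]; first by rewrite tr_scalar_mx.
by rewrite tr_form_scalar mulr_ge0 ?tr_gram_ge0.
Qed.

Lemma psd_subscalar_psd k (M : 'M[R]_k) (a : R) : 0 <= a -> psd (M - a%:M) -> psd M.
Proof.
by move=> a0 Ma; have := psdD Ma (psd_scalar k a0); rewrite subrK.
Qed.

Lemma cauchy_schwarz k (x y : 'cV[R]_k) :
  \tr (x^T *m y) ^+ 2 <= \tr (x^T *m x) * \tr (y^T *m y).
Proof. by have := psd_cauchy x y (psd_scalar k ler01); rewrite !mulmx1. Qed.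

Lemma psd_outerB k (x : 'cV[R]_k) : psd ((\tr (x^T *m x))%:M - x *m x^T).
Proof.
apply/psd_scalarBP; split=> [|y]; first by rewrite trmx_mul trmxK.
have -> : \tr (y^T *m (x *m x^T) *m y) = \tr (x^T *m y) ^+ 2.
  by rewrite mulmxA -mulmxA tr_mul11 tr_mulT expr2.
exact: cauchy_schwarz.
Qed.

Lemma psd_outer k (x : 'cV[R]_k) : psd (x *m x^T).
Proof.
split=> [|y]; first by rewrite trmx_mul trmxK.
have := tr_gram_ge0 (x^T *m y); by rewrite trmx_mul trmxK !mulmxA.
Qed.

Lemma tr_mul_outer k (M : 'M[R]_k) (x : 'cV[R]_k) :
  \tr (M *m (x *m x^T)) = \tr (x^T *m M *m x).
Proof. by rewrite mulmxA mxtrace_mulC mulmxA. Qed.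

(** One step of a coordinate-free Cholesky decomposition.  The deflated form is
    still nonnegative, by Cauchy-Schwarz for the form of [M], and [x] joins the
    kernel. *)
Lemma psd_deflate k (M : 'M[R]_k) (x : 'cV[R]_k) (c := \tr (x^T *m M *m x)) :
  psd M -> 0 < c ->
  let M' := M - c^-1 *: (M *m x *m (M *m x)^T) in
  psd M' /\ (\rank M' < \rank M)%N.
Proof.
move=> Mp c0 M'; have [Ms _] := Mp.
have M'E : M' = (1%:M - c^-1 *: (M *m x *m x^T)) *m M.
  by rewrite mulmxBl mul1mx -scalemxAl /M' trmx_mul Ms !mulmxA.
split.
  split=> [|y].
    by rewrite /M' linearB linearZ /= trmx_mul trmxK Ms.
  rewrite /M' mulmxBr mulmxBl raddfB /= -scalemxAr -scalemxAl mxtraceZ.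
  have -> : \tr (y^T *m (M *m x *m (M *m x)^T) *m y) = \tr (x^T *m M *m y) ^+ 2.
    have -> : y^T *m (M *m x *m (M *m x)^T) *m y = (y^T *m M *m x) *m (x^T *m M *m y).
      by rewrite trmx_mul Ms !mulmxA.
    by rewrite tr_mul11 (tr_form_sym x y Ms) expr2.
  rewrite subr_ge0 ler_pdivrMl//; exact: psd_cauchy.
have M'M : (M' <= M)%MS by rewrite M'E submxMl.
rewrite ltn_neqAle (mxrank_leqif_sup M'M).1 andbT (mxrank_leqif_sup M'M).2.
apply/negP => /submxP[Y MY].
have M'x : M' *m x = 0.
  have -> : M' *m x = M *m x - c^-1 *: (M *m x *m (x^T *m M *m x)).
    by rewrite /M' mulmxBl -scalemxAl trmx_mul Ms !mulmxA.
  by rewrite (mx11_tr (x^T *m M *m x)) mul_mx_scalar scalerA mulVf ?scale1r ?subrr// gt_eqF.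
by move: c0; rewrite /c -mulmxA MY -[Y *m M' *m x]mulmxA M'x !mulmx0 mxtrace0 ltxx.
Qed.

(** By linearity it suffices to write [N] as a sum of rank-one terms [y *m y^T],
    for which the trace is the form of [M] at [y]; repeated deflation provides
    this decomposition, whence the induction on the rank. *)
Lemma psd_tr_mul_ge0 k (M N : 'M[R]_k) : psd M -> psd N -> 0 <= \tr (M *m N).
Proof.
move=> Mp; move: {2}(\rank N).+1 (ltnSn (\rank N)) => r.
elim: r N => [//|r IH] N; rewrite ltnS => Nr Np.
have [N0|/existsNP[x /eqP Nx]] := pselect (forall x : 'cV[R]_k, \tr (x^T *m N *m x) = 0).
  suff -> : N = 0 by rewrite mulmx0 mxtrace0.
  by apply/trmx_inj/row_matrixP => i; rewrite -tr_col colE psd_ker// !linear0.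
have c0 : 0 < \tr (x^T *m N *m x) by rewrite lt_def Nx Np.2.
have [Np' Nr'] := psd_deflate Np c0.
set c := \tr _ in c0 Np' Nr'.
have -> : N = (N - c^-1 *: (N *m x *m (N *m x)^T)) + c^-1 *: (N *m x *m (N *m x)^T).
  by rewrite subrK.
rewrite mulmxDr mxtraceD addr_ge0//; first by rewrite IH// (leq_trans Nr').
rewrite -scalemxAr mxtraceZ mulr_ge0 ?invr_ge0 ?(ltW c0)//.
by rewrite tr_mul_outer Mp.2.
Qed.

Lemma psd_tr_ge0 k (M : 'M[R]_k) : psd M -> 0 <= \tr M.
Proof. by move=> Mp; have := psd_tr_mul_ge0 (psd_scalar k ler01) Mp; rewrite mul1mx. Qed.

Lemma psd_trB k (M : 'M[R]_k) : psd M -> psd ((\tr M)%:M - M).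
Proof.
move=> Mp; apply/psd_scalarBP; split=> [|x]; first exact: Mp.1.
have := psd_tr_mul_ge0 (psd_outerB x) Mp.
rewrite mulmxBl mul_scalar_mx raddfB /= mxtraceZ subr_ge0.
by rewrite (mxtrace_mulC (x *m x^T)) tr_mul_outer mulrC.
Qed.

Lemma tr_mul_le k (M N : 'M[R]_k) (a : R) :
  psd (a%:M - M) -> psd N -> \tr (M *m N) <= a * \tr N.
Proof.
move=> Ma Np; have := psd_tr_mul_ge0 Ma Np.
by rewrite mulmxBl mul_scalar_mx raddfB /= mxtraceZ subr_ge0.
Qed.

Lemma tr_mul_ge k (M N : 'M[R]_k) (a : R) :
  psd (M - a%:M) -> psd N -> a * \tr N <= \tr (M *m N).
Proof.
move=> Ma Np; have := psd_tr_mul_ge0 Ma Np.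
by rewrite mulmxBl mul_scalar_mx raddfB /= mxtraceZ subr_ge0.
Qed.

Lemma tr_form_le k l (M : 'M[R]_k) (a : R) (Y : 'M[R]_(k, l)) :
  psd (a%:M - M) -> \tr (Y^T *m M *m Y) <= a * \tr (Y^T *m Y).
Proof.
move=> /(psd_tr_congr Y).
by rewrite mulmxBr mulmxBl raddfB /= subr_ge0 tr_form_scalar.
Qed.

Lemma tr_form_ge k l (M : 'M[R]_k) (a : R) (Y : 'M[R]_(k, l)) :
  psd (M - a%:M) -> a * \tr (Y^T *m Y) <= \tr (Y^T *m M *m Y).
Proof.
move=> /(psd_tr_congr Y).
by rewrite mulmxBr mulmxBl raddfB /= subr_ge0 tr_form_scalar.
Qed.

(** Cauchy-Schwarz for the form of [M] at [M *m x] and [x] bounds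
    [|M x|^4] by [(a |M x|^2) (a |x|^2)]. *)
Lemma psd_sqr_le k (M : 'M[R]_k) (a : R) : 0 <= a ->
  psd M -> psd (a%:M - M) -> psd ((a ^+ 2)%:M - M *m M).
Proof.
move=> a0 Mp Ma; have [Ms M0] := Mp; apply/psd_scalarBP; split=> [|x].
  by rewrite trmx_mul Ms.
set y := M *m x.
have yE : \tr (x^T *m (M *m M) *m x) = \tr (y^T *m y).
  by rewrite trmx_mul Ms !mulmxA.
have := psd_cauchy y x Mp; rewrite -mulmxA -/y.
have := tr_form_le x Ma; have := tr_form_le y Ma; have := tr_gram_ge0 y.
have := tr_gram_ge0 x; have := M0 x; have := M0 y; rewrite yE.
set p := \tr (y^T *m M *m y); set q := \tr (x^T *m M *m x).
set r := \tr (x^T *m x); set s := \tr (y^T *m y) => p0 q0 r0 s0 pa qa psq.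
have [->|s1] := eqVneq s 0; first by rewrite mulr_ge0// sqr_ge0.
rewrite -(ler_pM2l (x := s)) ?lt_def ?s1// -expr2 (le_trans psq)//.
have -> : s * (a ^+ 2 * r) = (a * s) * (a * r) by ring.
exact: ler_pM.
Qed.

Lemma psd_sqr_ge k (M : 'M[R]_k) (a : R) : 0 <= a ->
  psd (M - a%:M) -> psd (M *m M - (a ^+ 2)%:M).
Proof.
move=> a0 /psd_subscalarP[Ms Ma]; apply/psd_subscalarP; split=> [|x].
  by rewrite trmx_mul Ms.
set y := M *m x.
have -> : \tr (x^T *m (M *m M) *m x) = \tr (y^T *m y) by rewrite trmx_mul Ms !mulmxA.
have := cauchy_schwarz x y; rewrite /y mulmxA -/y.
have := Ma x; have := tr_gram_ge0 x; have := tr_gram_ge0 y.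
set p := \tr (y^T *m y); set r := \tr (x^T *m x).
set q := \tr (x^T *m M *m x) => p0 r0 arq qpr.
have [->|r1] := eqVneq r 0; first by rewrite mulr0.
rewrite -(ler_pM2l (x := r)) ?lt_def ?r1//; apply: le_trans qpr.
have -> : r * (a ^+ 2 * r) = (a * r) ^+ 2 by ring.
by rewrite lerXn2r// nnegrE ?mulr_ge0// (le_trans _ arq) ?mulr_ge0.
Qed.

Lemma nonunit_kernel k (M : 'M[R]_k) : M \notin unitmx -> M^T = M ->
  exists2 x : 'cV[R]_k, x != 0 & M *m x = 0.
Proof.
rewrite -row_free_unit -kermx_eq0 => M0 Ms.
have [i xi] : exists i, row i (kermx M) != 0.
  apply/existsP; apply: contraNT M0; rewrite negb_exists => /forallP M0.
  by apply/eqP/row_matrixP => i; rewrite linear0; apply/eqP; rewrite -[_ == _]negbK M0.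
exists (row i (kermx M))^T; first by rewrite trmx_eq0.
by apply: trmx_inj; rewrite trmx_mul trmxK Ms -row_mul mulmx_ker !linear0.
Qed.

Lemma psd_unit k (M : 'M[R]_k) (a : R) : 0 < a -> psd (M - a%:M) -> M \in unitmx.
Proof.
move=> a0 /psd_subscalarP[Ms Ma]; apply/negPn/negP => /nonunit_kernel/(_ Ms)[x x0 Mx].
have := Ma x; rewrite -mulmxA Mx mulmx0 mxtrace0 leNgt.
by rewrite mulr_gt0// tr_gram_gt0.
Qed.

Lemma invmx_sym k (M : 'M[R]_k) : M^T = M -> (invmx M)^T = invmx M.
Proof. by move=> Ms; rewrite trmx_inv Ms. Qed.

Lemma tr_form_inv k (M : 'M[R]_k) (x : 'cV[R]_k) : M^T = M -> M \in unitmx ->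
  \tr ((invmx M *m x)^T *m M *m (invmx M *m x)) = \tr (x^T *m invmx M *m x).
Proof.
move=> Ms Mu; rewrite trmx_mul invmx_sym// !mulmxA -[_ *m invmx M *m M]mulmxA.
by rewrite mulVmx// mulmx1.
Qed.

Lemma psd_inv k (M : 'M[R]_k) : psd M -> M \in unitmx -> psd (invmx M).
Proof.
by move=> [Ms Mp] Mu; split=> [|x]; [exact: invmx_sym|rewrite -tr_form_inv].
Qed.

(** With [y = M^-1 x] one has [a |y|^2 <= <x, y> <= |x| |y|]; eliminating [|y|]
    bounds the form [<x, y>] of the inverse. *)
Lemma psd_inv_le k (M : 'M[R]_k) (a : R) : 0 < a ->
  psd (M - a%:M) -> psd (a^-1%:M - invmx M).
Proof.
move=> a0 Ma; have Mu := psd_unit a0 Ma.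
have /psd_subscalarP[Ms Ma'] := Ma.
apply/psd_scalarBP; split=> [|x]; first exact: invmx_sym.
set y := invmx M *m x.
have := Ma' y; rewrite tr_form_inv//; set s := \tr (x^T *m _ *m x) => ys.
have := cauchy_schwarz x y; rewrite /y mulmxA -/y -/s.
move: (tr_gram_ge0 x) (tr_gram_ge0 y) ys.
 set p := \tr (x^T *m x); set q := \tr (y^T *m y) => p0 q0 aqs spq.
have s0 : 0 <= s by apply: le_trans aqs; rewrite mulr_ge0// ltW.
have [->|s1] := eqVneq s 0; first by rewrite mulr_ge0// invr_ge0 ltW.
rewrite ler_pdivlMl// -(ler_pM2l (x := s)) ?lt_def ?s1//.
have -> : s * (a * s) = a * s ^+ 2 by ring.
apply: (@le_trans _ _ (a * (p * q))); first by rewrite ler_pM2l.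
have -> : a * (p * q) = p * (a * q) by ring.
by rewrite [s * p]mulrC ler_wpM2l.
Qed.

(** Cauchy-Schwarz for the form of [M] at [M^-1 x] and [x] reads
    [|x|^4 <= <x, M^-1 x> <x, M x>]. *)
Lemma psd_inv_ge k (M : 'M[R]_k) (a : R) : 0 < a -> psd M -> M \in unitmx ->
  psd (a%:M - M) -> psd (invmx M - a^-1%:M).
Proof.
move=> a0 Mp Mu /psd_scalarBP[Ms Ma].
apply/psd_subscalarP; split=> [|x]; first exact: invmx_sym.
set y := invmx M *m x.
have := psd_cauchy y x Mp; rewrite tr_form_inv// => xx.
have yx : \tr (y^T *m M *m x) = \tr (x^T *m x).
  by rewrite /y trmx_mul invmx_sym// -!mulmxA mulKmx.
move: xx (Ma x) (Mp.2 y) (tr_gram_ge0 x); rewrite yx tr_form_inv//.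
set r := \tr (x^T *m x); set s := \tr (x^T *m invmx M *m x).
set q := \tr (x^T *m M *m x) => rsq qar s0 r0.
have [->|r1] := eqVneq r 0; first by rewrite mulr0.
rewrite ler_pdivrMl// -(ler_pM2l (x := r)) ?lt_def ?r1// -expr2 (le_trans rsq)//.
have -> : r * (a * s) = s * (a * r) by ring.
exact: ler_wpM2l.
Qed.

(** The inverse is positive semidefinite, hence at most its trace, and inverting
    an upper bound gives a positive lower bound.  This replaces compactness of the
    unit sphere in the proof that extreme eigenvalues exist. *)
Lemma psd_unit_coercive k (M : 'M[R]_k) : psd M -> M \in unitmx ->
  exists2 a : R, 0 < a & psd (M - a%:M).
Proof.
move=> Mp Mu; have Np := psd_inv Mp Mu.
pose a := (\tr (invmx M) + 1).
have a0 : 0 < a by rewrite ltr_wpDl// psd_tr_ge0.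
exists a^-1; first by rewrite invr_gt0.
rewrite -[M]invmxK; apply: psd_inv_ge => //; first by rewrite unitmx_inv.
have -> : a%:M - invmx M = ((\tr (invmx M))%:M - invmx M) + 1%:M.
  by rewrite /a raddfD /= addrAC.
by apply: psdD; [exact: psd_trB|exact: psd_scalar].
Qed.

End PositiveSemidefinite.

(** * Extreme eigenvalues and the spectral norm *)

Section ExtremeEigenvalues.
Context {R : realType}.
Implicit Types (k : nat).

Lemma eigen_colP k (M : 'M[R]_k) (a : R) : M^T = M ->
  eigenvalue M a <-> exists2 x : 'cV[R]_k, x != 0 & M *m x = a *: x.
Proof.
move=> Ms; split=> [/eigenvalueP[v vM v0]|[x x0 Mx]].
  exists v^T; first by rewrite trmx_eq0.
  by rewrite -{1}Ms -trmx_mul vM linearZ.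
apply/eigenvalueP; exists x^T; last by rewrite trmx_eq0.
by rewrite -{1}Ms -trmx_mul Mx linearZ.
Qed.

Lemma eigenvalueN k (M : 'M[R]_k) (a : R) : M^T = M ->
  eigenvalue (- M) a <-> eigenvalue M (- a).
Proof.
move=> Ms; have Ns : (- M)^T = - M by rewrite linearN /= Ms.
split=> /eigen_colP[]// x x0; rewrite ?mulNmx => Mx; apply/eigen_colP => //; exists x => //.
  by rewrite scaleNr -Mx opprK.
by rewrite mulNmx Mx scaleNr opprK.
Qed.

Lemma eigenvalue_ge k (M : 'M[R]_k) (a b : R) :
  psd (M - a%:M) -> eigenvalue M b -> a <= b.
Proof.
move=> /psd_subscalarP[Ms Ma] /eigen_colP[]// x x0 Mx.
have := Ma x; rewrite -mulmxA Mx -scalemxAr mxtraceZ ler_pM2r//.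
by rewrite tr_gram_gt0.
Qed.

(** Take the supremum [a] of the [t] with [M - t%:M] positive semidefinite.  Were
    [M - a%:M] invertible, coercivity would leave room to increase [a]. *)
Lemma least_eigenvalue k (M : 'M[R]_k.+1) (t : R) : psd (M - t%:M) ->
  exists2 a, eigenvalue M a & psd (M - a%:M).
Proof.
move=> Mt; have [Ms _] := (psd_subscalarP _ _).1 Mt.
pose T := [set t | psd (M - t%:M)].
have e0 : (delta_mx 0 0 : 'cV[R]_k.+1) != 0.
  apply/eqP => /matrixP/(_ 0 0); rewrite !mxE eqxx => /eqP; by rewrite oner_eq0.
have T0 : T !=set0 by exists t.
have supT : has_sup T.
  split => //; set e := delta_mx 0 0 in e0.
  exists (\tr (e^T *m M *m e) / \tr (e^T *m e)) => s /psd_subscalarP[_ /(_ e)].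
  by rewrite ler_pdivlMr// tr_gram_gt0.
pose a := sup T.
have Ma : psd (M - a%:M).
  apply/psd_subscalarP; split=> // x.
  have [->|x0] := eqVneq x 0; first by rewrite !mulmx0 mxtrace0 mulr0.
  have xx : 0 < \tr (x^T *m x) by rewrite tr_gram_gt0.
  rewrite -ler_pdivlMr// ge_sup// => s /psd_subscalarP[_ /(_ x)].
  by rewrite ler_pdivlMr.
exists a => //.
have [u|] := boolP (M - a%:M \in unitmx).
  have [c c0 Mac] := psd_unit_coercive Ma u.
  have : T (a + c) by rewrite /T /= raddfD /= opprD addrA.
  by move=> /(ub_le_sup supT.2); rewrite -/a gerDl leNgt c0.
move=> /nonunit_kernel[|x x0 Mx]; first exact: Ma.1.
apply/eigen_colP => //; exists x => //.
by apply/eqP; rewrite -subr_eq0 -mul_scalar_mx -mulmxBl Mx.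
Qed.

Lemma lambda_minP k (M : 'M[R]_k.+1) (t : R) : psd (M - t%:M) ->
  eigenvalue M (lambda_min M) /\ psd (M - (lambda_min M)%:M).
Proof.
move=> /least_eigenvalue[a Ma psdMa].
suff -> : lambda_min M = a by [].
have lbE : lbound [set b | eigenvalue M b] a by move=> b; exact: eigenvalue_ge.
apply/eqP; rewrite eq_le; apply/andP; split.
  by apply: ge_inf => //; exists a.
by apply: lb_le_inf => //; exists a.
Qed.

Lemma lambda_maxP k (M : 'M[R]_k.+1) (t : R) : psd (t%:M - M) ->
  eigenvalue M (lambda_max M) /\ psd ((lambda_max M)%:M - M).
Proof.
move=> Mt; have [Ms _] := (psd_scalarBP _ _).1 Mt.
have E c : - M - (- c)%:M = c%:M - M by rewrite raddfN /= opprK addrC.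
have [a Ma psdMa] : exists2 a, eigenvalue M a & psd (a%:M - M).
  have := @least_eigenvalue _ (- M) (- t); rewrite E => /(_ Mt)[a] /eigenvalueN -/(_ Ms).
  by rewrite -{2}[a]opprK E; exists (- a).
suff -> : lambda_max M = a by [].
have ubE : ubound [set b | eigenvalue M b] a.
  move=> b /= Mb; have := @eigenvalue_ge _ (- M) (- a) (- b).
  by rewrite E lerN2; apply => //; apply/eigenvalueN => //; rewrite opprK.
apply/eqP; rewrite eq_le; apply/andP; split.
  by apply: ge_sup => //; exists a.
by apply: ub_le_sup => //; exists a.
Qed.

Lemma psd_lambda_min k (M : 'M[R]_k) : (0 < k)%N -> psd M ->
  psd (M - (lambda_min M)%:M).
Proof.
case: k M => // k M _ Mp.
by apply: (@lambda_minP _ _ 0 _).2; rewrite raddf0 subr0.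
Qed.

Lemma psd_lambda_max k (M : 'M[R]_k) : (0 < k)%N -> psd M ->
  psd ((lambda_max M)%:M - M).
Proof.
case: k M => // k M _ Mp.
by apply: (@lambda_maxP _ _ (\tr M) _).2; exact: psd_trB.
Qed.

Lemma posdef_lambda_min_gt0 k (M : 'M[R]_k) : (0 < k)%N -> posdef M ->
  0 < lambda_min M.
Proof.
case: k M => // k M _ Mp; have Mpsd := posdef_psd Mp.
have [|Me _] := @lambda_minP _ M 0; first by rewrite raddf0 subr0.
have [x x0 Mx] := (eigen_colP _ Mp.1).1 Me.
have := Mp.2 x x0; rewrite -mulmxA Mx -scalemxAr mxtraceZ pmulr_lgt0//.
by rewrite tr_gram_gt0.
Qed.

Lemma lambda_min_le_max k (M : 'M[R]_k) : (0 < k)%N -> psd M ->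
  lambda_min M <= lambda_max M.
Proof.
case: k M => // k M _ Mp.
have [|Me _] := @lambda_minP _ M 0; first by rewrite raddf0 subr0.
have [|_ Mmax] := @lambda_maxP _ M (\tr M); first exact: psd_trB.
have [Ms _] := Mp.
rewrite -lerN2; apply: (@eigenvalue_ge _ (- M)).
  by rewrite raddfN /= opprK addrC.
by apply/eigenvalueN => //; rewrite opprK.
Qed.

(** [<y, M y> <= |M y|] on unit vectors, by Cauchy-Schwarz, and [|M y|] is at
    most the supremum, which is over a set bounded by the trace of [M]. *)
Lemma psd_spectral_norm k (M : 'M[R]_k) : psd M -> psd ((spectral_norm M)%:M - M).
Proof.
move=> Mp; have [Ms M0] := Mp; apply/psd_scalarBP; split=> // x.
have [->|x0] := eqVneq x 0; first by rewrite !mulmx0 mxtrace0 mulr0.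
have xx : 0 < \tr (x^T *m x) by rewrite tr_gram_gt0.
pose nx := frobenius x; have nx0 : 0 < nx by rewrite /nx /frobenius sqrtr_gt0.
have nx2 : nx ^+ 2 = \tr (x^T *m x) by rewrite sqr_sqrtr// ltW.
pose y := nx^-1 *: x.
have yy : \tr (y^T *m y) = 1.
  by rewrite /y tr_gramZ -nx2 exprVn mulVf// expf_neq0// lt0r_neq0.
have Mbound (z : 'cV[R]_k) : \tr ((M *m z)^T *m (M *m z)) <= \tr M ^+ 2 * \tr (z^T *m z).
  rewrite trmx_mul Ms !mulmxA -[z^T *m M *m M]mulmxA.
  by apply: tr_form_le; apply: psd_sqr_le => //; [exact: psd_tr_ge0|exact: psd_trB].
have My : frobenius (M *m y) <= spectral_norm M.
  apply: ub_le_sup; last by exists y => //=; rewrite /frobenius yy sqrtr1.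
  exists (\tr M) => _ [z /= z1 <-].
  have zz : \tr (z^T *m z) = 1.
    by rewrite -[LHS]sqr_sqrtr ?tr_gram_ge0// -/(frobenius z) z1 expr1n.
  rewrite -[leRHS]ger0_norm ?psd_tr_ge0// -sqrtr_sqr ler_wsqrtr//.
  by have := Mbound z; rewrite zz mulr1.
have yMy : \tr (y^T *m M *m y) <= spectral_norm M.
  apply: le_trans My; rewrite -[leLHS]mulr1.
  have [n0|n1] := leP (\tr (y^T *m M *m y)) 0.
    by rewrite mulr1 (le_trans n0)// sqrtr_ge0.
  rewrite mulr1 -[leLHS]gtr0_norm// -sqrtr_sqr ler_wsqrtr//.
  by have := cauchy_schwarz y (M *m y); rewrite yy mul1r mulmxA.
have -> : x = nx *: y by rewrite scalerA divff ?scale1r ?lt0r_neq0.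
by rewrite tr_formZ tr_gramZ yy mulr1 mulrC ler_pM2r// exprn_gt0.
Qed.

Lemma spectral_norm_ge0 k (M : 'M[R]_k) : 0 <= spectral_norm M.
Proof.
rewrite /spectral_norm; set E := (X in sup X).
have [[[y Ey] ubE]|/sup_out->//] := pselect (has_sup E).
by apply: le_trans (ub_le_sup ubE Ey); case: Ey => x _ <-; exact: sqrtr_ge0.
Qed.

End ExtremeEigenvalues.

(** * First-order remainder of the objective *)

Section Objective.
Context {R : realType}.
Implicit Types (k : nat).

(** The resolvent identity [P^-1 - Q^-1 = P^-1 (Q - P) Q^-1], used twice. *)
Lemma invmx_second_order k (P Q : 'M[R]_k) : P \in unitmx -> Q \in unitmx ->
  invmx Q = invmx P - invmx P *m (Q - P) *m invmx P
    + invmx P *m (Q - P) *m invmx Q *m (Q - P) *m invmx P.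
Proof.
move=> Pu Qu.
have PQ : invmx P *m (Q - P) *m invmx Q = invmx P - invmx Q.
  by rewrite mulmxBr mulmxBl mulVmx// mul1mx mulmxK.
have QP : invmx Q *m (Q - P) *m invmx P = invmx P - invmx Q.
  by rewrite mulmxBr mulmxBl mulVmx// mul1mx mulmxK.
by rewrite PQ mulmxBl mulmxBl QP opprB addrA addrNK addrC subrK.
Qed.

(** The remainder of the first-order expansion in closed form; convexity,
    smoothness and strong convexity are all read off from it. *)
Lemma objective_remainder k (W S0 X Y : 'M[R]_k) :
  psd W -> psd (S0 + X) -> S0 + X \in unitmx -> S0 + Y \in unitmx ->
  objective W S0 Y - objective W S0 X - \tr ((objective_grad W S0 X)^T *m (Y - X)) =
  \tr (W *m (invmx (S0 + X) *m (Y - X) *m invmx (S0 + Y) *m (Y - X) *m invmx (S0 + X))).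
Proof.
move=> [Ws _] [Ps _] Pu Qu; rewrite /objective /objective_grad.
have YX : S0 + Y - (S0 + X) = Y - X by rewrite opprD addrACA subrr add0r.
have := invmx_second_order Pu Qu; rewrite YX.
set P := S0 + X in Ps Pu *; set Q := S0 + Y in Qu *; set E := Y - X => {1}->.
set rest := invmx P *m E *m invmx Q *m E *m invmx P.
have -> : \tr ((- (invmx P *m W *m invmx P))^T *m E) =
    - \tr (W *m (invmx P *m E *m invmx P)).
  have -> : (- (invmx P *m W *m invmx P))^T = - (invmx P *m W *m invmx P).
    by rewrite linearN /= !trmx_mul Ws (invmx_sym Ps) mulmxA.
  by rewrite mulNmx raddfN /= -!mulmxA mxtrace_mulC !mulmxA.
by rewrite mulmxDr mulmxBr mxtraceD raddfB /=; ring.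
Qed.

(** The factors are peeled off from the outside: first [W <= s], then
    [Q^-1 <= c^-1], and, after cyclic permutation, [P^-1 P^-1 <= c^-2]. *)
Lemma remainder_le k (W P Q E : 'M[R]_k) (s c : R) : 0 <= s -> 0 < c -> E^T = E ->
  psd (s%:M - W) -> psd (P - c%:M) -> psd (Q - c%:M) ->
  \tr (W *m (invmx P *m E *m invmx Q *m E *m invmx P)) <= s / c ^+ 3 * \tr (E^T *m E).
Proof.
move=> s0 c0 Es Ws Pc Qc.
have Ps : P^T = P by case/psd_subscalarP: Pc.
have psdP : psd P by apply: psd_subscalar_psd (ltW c0) Pc.
have psdQ : psd Q by apply: psd_subscalar_psd (ltW c0) Qc.
pose Y := E *m invmx P.
have YE : invmx P *m E *m invmx Q *m E *m invmx P = Y^T *m invmx Q *m Y.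
  by rewrite /Y trmx_mul Es invmx_sym// !mulmxA.
have Z := psd_congr Y (psd_inv psdQ (psd_unit c0 Qc)).
rewrite YE; apply: le_trans (tr_mul_le Ws Z) _.
rewrite -mulrA ler_wpM2l//; apply: le_trans (tr_form_le Y (psd_inv_le c0 Qc)) _.
have -> : \tr (Y^T *m Y) = \tr (E^T *m (invmx P *m invmx P) *m E).
  by rewrite mxtrace_mulC /Y trmx_mul invmx_sym// Es !mulmxA.
have := psd_sqr_le _ (psd_inv psdP (psd_unit c0 Pc)) (psd_inv_le c0 Pc).
rewrite invr_ge0 ltW// => /(_ isT) /(tr_form_le E) PE.
have -> : (c ^+ 3)^-1 = c^-1 * c^-1 ^+ 2 by rewrite -exprVn exprS.
by rewrite -mulrA ler_pM2l ?invr_gt0.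
Qed.

Lemma remainder_ge k (W P Q E : 'M[R]_k) (s c : R) : 0 <= s -> 0 < c -> E^T = E ->
  psd (W - s%:M) -> psd P -> P \in unitmx -> psd Q -> Q \in unitmx ->
  psd (c%:M - P) -> psd (c%:M - Q) ->
  s / c ^+ 3 * \tr (E^T *m E) <= \tr (W *m (invmx P *m E *m invmx Q *m E *m invmx P)).
Proof.
move=> s0 c0 Es Ws psdP Pu psdQ Qu Pc Qc.
have Ps := psdP.1.
pose Y := E *m invmx P.
have YE : invmx P *m E *m invmx Q *m E *m invmx P = Y^T *m invmx Q *m Y.
  by rewrite /Y trmx_mul Es invmx_sym// !mulmxA.
have Z := psd_congr Y (psd_inv psdQ Qu).
rewrite YE; apply: le_trans (tr_mul_ge Ws Z).
rewrite -mulrA ler_wpM2l//; apply: le_trans (tr_form_ge Y (psd_inv_ge c0 psdQ Qu Qc)).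
have -> : \tr (Y^T *m Y) = \tr (E^T *m (invmx P *m invmx P) *m E).
  by rewrite mxtrace_mulC /Y trmx_mul invmx_sym// Es !mulmxA.
have := psd_sqr_ge _ (psd_inv_ge c0 psdP Pu Pc).
rewrite invr_ge0 ltW// => /(_ isT) /(tr_form_ge E) PE.
have -> : (c ^+ 3)^-1 = c^-1 * c^-1 ^+ 2 by rewrite -exprVn exprS.
by rewrite -mulrA ler_pM2l ?invr_gt0.
Qed.

Lemma psd_tr_sqr_le k (X : 'M[R]_k) : psd X -> \tr (X^T *m X) <= \tr X ^+ 2.
Proof.
move=> Xp; rewrite Xp.1 expr2.
exact: tr_mul_le (psd_trB Xp) Xp.
Qed.

(** The cross term is [- 2 Tr(X Y) <= 0]. *)
Lemma psd_tr_sqrB_le k (X Y : 'M[R]_k) : psd X -> psd Y ->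
  \tr ((X - Y)^T *m (X - Y)) <= \tr X ^+ 2 + \tr Y ^+ 2.
Proof.
move=> Xp Yp; have := psd_tr_sqr_le Xp; have := psd_tr_sqr_le Yp.
have := psd_tr_mul_ge0 Xp Yp.
have -> : (X - Y)^T = X - Y by rewrite linearB /= Xp.1 Yp.1.
rewrite Xp.1 Yp.1 mulmxBl !mulmxBr !raddfB /= [\tr (Y *m X)]mxtrace_mulC.
lra.
Qed.

End Objective.

(** * The inexact Frank-Wolfe method *)

(** The first step size is 1, which erases the initial gap.  The induction step
    reduces to [(m + 1) (m + 3) <= (m + 2)^2]. *)
Lemma frank_wolfe_recursion (R : realType) (h : nat -> R) (C delta : R) :
  0 <= C -> 0 <= delta ->
  (forall i, h i.+1 <= (1 - 2 / (i%:R + 2)) * h i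
     + (2 / (i%:R + 2)) ^+ 2 / 2 * C + 2 / (i%:R + 2) * delta) ->
  forall M, (1 <= M)%N -> h M <= 2 * C / (M%:R + 2) + delta.
Proof.
move=> C0 delta0 hS; elim=> // -[_ _|M IH _].
  have := hS 0%N; have -> : 2 / (0%:R + 2) = 1 :> R by rewrite add0r divff.
  have -> : 2 * C / (1%:R + 2) = 2 * C / 3 by congr (_ / _); ring.
  rewrite subrr mul0r add0r expr1n mul1r; lra.
have {IH} := IH isT; have := hS M.+1.
set m := M.+1%:R; have m0 : 0 <= m by rewrite ler0n.
have -> : M.+2%:R = m + 1 :> R by rewrite /m -natr1.
move: (h M.+1) (h M.+2) => h1 h2 h21 h1le.
have m2 : 0 < m + 2 by lra.
have al1 : 0 <= 1 - 2 / (m + 2).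
  have -> : 1 - 2 / (m + 2) = m / (m + 2) by field; lra.
  by rewrite divr_ge0// ltW.
apply: (le_trans h21); apply: (@le_trans _ _
  ((1 - 2 / (m + 2)) * (2 * C / (m + 2) + delta)
   + (2 / (m + 2)) ^+ 2 / 2 * C + 2 / (m + 2) * delta)).
  by rewrite !lerD2r ler_wpM2l.
have -> : (1 - 2 / (m + 2)) * (2 * C / (m + 2) + delta)
   + (2 / (m + 2)) ^+ 2 / 2 * C + 2 / (m + 2) * delta
   = 2 * C * ((m + 1) / (m + 2) ^+ 2) + delta by field; lra.
rewrite lerD2r -mulrA -mulrA ler_pM2l// ler_wpM2l// ler_pdivrMr ?exprn_gt0//.
rewrite mulrC ler_pdivlMr; last by lra.
nra.
Qed.

Section ConvexDomain.
Context {R : realType} {k : nat}.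
Variables (k_gt0 : (0 < k)%N) (W S0 : 'M[R]_k) (W_pd : posdef W) (S0_pd : posdef S0).
Variables (D : set 'M[R]_k) (tau : R).
Hypothesis D_psd : forall X, D X -> psd X.
Hypothesis D_tr : forall X, D X -> \tr X <= tau.
Hypothesis D_convex : forall X Y (t : R), 0 <= t <= 1 -> D X -> D Y ->
  D ((1 - t) *: X + t *: Y).

Let f := objective W S0.
Let gradf := objective_grad W S0.
Let Cf := curvature_constant D f gradf.
Let W_psd := posdef_psd W_pd.
Let S0_psd := posdef_psd S0_pd.
Let smin_gt0 : 0 < lambda_min S0 := posdef_lambda_min_gt0 k_gt0 S0_pd.

Lemma shifted_psd X : psd X -> psd (S0 + X - (lambda_min S0)%:M).
Proof. by move=> Xp; rewrite addrAC; apply: psdD => //; exact: psd_lambda_min. Qed.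

Lemma shifted_unit X : psd X -> S0 + X \in unitmx.
Proof. by move=> /shifted_psd; exact: psd_unit. Qed.

Lemma shifted_le X : D X -> psd ((lambda_max S0 + tau)%:M - (S0 + X)).
Proof.
move=> DX; have Xp := D_psd DX; have tX := D_tr DX.
have -> : (lambda_max S0 + tau)%:M - (S0 + X) =
    ((lambda_max S0)%:M - S0) + ((tau - \tr X)%:M + ((\tr X)%:M - X)).
  by apply/matrixP => i j; rewrite !mxE; case: (i == j); rewrite ?mulr1n ?mulr0n; ring.
apply: psdD; first exact: psd_lambda_max.
by apply: psdD; [apply: psd_scalar; rewrite subr_ge0|exact: psd_trB].
Qed.

Lemma gradient_psd X : psd X -> psd (- gradf X).
Proof.
move=> Xp; have Ps : psd (S0 + X) by exact: psdD.
have := psd_congr (invmx (S0 + X)) W_psd.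
by rewrite /gradf /objective_grad opprK invmx_sym//; case: Ps.
Qed.

Lemma gradient_sym X : psd X -> (gradf X)^T = gradf X.
Proof. by move=> /gradient_psd[gs _]; apply/oppr_inj/etrans/gs/matrixP => i j; rewrite !mxE. Qed.

Lemma smooth_bound X Y : psd X -> psd Y ->
  f Y - f X - \tr ((gradf X)^T *m (Y - X)) <=
  spectral_norm W / lambda_min S0 ^+ 3 * \tr ((Y - X)^T *m (Y - X)).
Proof.
move=> Xp Yp; rewrite objective_remainder ?shifted_unit//; last exact: psdD.
apply: remainder_le => //; last 3 first.
- exact: psd_spectral_norm.
- exact: shifted_psd.
- exact: shifted_psd.
- exact: spectral_norm_ge0.
- by rewrite linearB /= Xp.1 Yp.1.
Qed.

Lemma upper_shift_gt0 X : D X -> 0 < lambda_max S0 + tau.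
Proof.
move=> DX; have tau0 : 0 <= tau.
  by apply: le_trans (D_tr DX); apply/psd_tr_ge0/D_psd.
by rewrite ltr_pwDl// (lt_le_trans smin_gt0)// lambda_min_le_max.
Qed.

Lemma modulus_gt0 X : D X -> 0 < lambda_min W / (lambda_max S0 + tau) ^+ 3.
Proof.
move=> DX; rewrite divr_gt0 ?posdef_lambda_min_gt0// exprn_gt0//.
exact: upper_shift_gt0 DX.
Qed.

(** The modulus absorbs the factor 1/2 of the usual definition: with
    [tau = beta / mu] it is half of the strong convexity constant m_f. *)
Lemma strong_convexity X Y : D X -> D Y ->
  lambda_min W / (lambda_max S0 + tau) ^+ 3 * \tr ((Y - X)^T *m (Y - X)) <=
  f Y - f X - \tr ((gradf X)^T *m (Y - X)).
Proof.
move=> DX DY; have Xp := D_psd DX; have Yp := D_psd DY.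
rewrite objective_remainder ?shifted_unit//; last exact: psdD.
apply: remainder_ge; rewrite ?shifted_unit//.
- exact/ltW/posdef_lambda_min_gt0.
- exact: upper_shift_gt0 DX.
- by rewrite linearB /= Xp.1 Yp.1.
- exact: psd_lambda_min.
- exact: psdD.
- exact: psdD.
- exact: shifted_le.
- exact: shifted_le.
Qed.

Lemma segment_in_D X Y (t : R) : 0 <= t <= 1 -> D X -> D Y -> D (X + t *: (Y - X)).
Proof.
move=> t01 DX DY; have -> : X + t *: (Y - X) = (1 - t) *: X + t *: Y.
  by rewrite scalerBl scale1r scalerBr addrA addrAC.
exact: D_convex.
Qed.

(** The squared diameter is at most [2 tau^2], as members of [D] have nonnegative
    inner products and Frobenius norms at most their traces; together with the factor 2 in the definition of the curvature
    constant this gives 4. *)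
Lemma curvature_le : (Cf <= (4 * spectral_norm W * tau ^+ 2 / lambda_min S0 ^+ 3)%:E)%E.
Proof.
apply: ge_ereal_sup => _ [X [S [g [DX DS /andP[g0 g1] ->]]]].
have DY := @segment_in_D X S g; rewrite lee_fin.
have {}DY : D (X + g *: (S - X)) by apply: DY => //; rewrite ltW.
have Xp := D_psd DX; have Sp := D_psd DS.
have := smooth_bound Xp (D_psd DY).
rewrite [_ + _ *: _ - X]addrC addKr -scalemxAr mxtraceZ tr_gramZ => up.
set c := spectral_norm W / _ in up *.
have c0 : 0 <= c by rewrite divr_ge0 ?spectral_norm_ge0 ?exprn_ge0 ?ltW.
have tau0 X' : D X' -> \tr X' ^+ 2 <= tau ^+ 2.
  move=> DX'; have t0 := psd_tr_ge0 (D_psd DX').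
  by rewrite lerXn2r ?nnegrE ?D_tr// (le_trans t0)// D_tr.
have SX : \tr ((S - X)^T *m (S - X)) <= 2 * tau ^+ 2.
  apply: le_trans (psd_tr_sqrB_le Sp Xp) _.
  have := tau0 _ DX; have := tau0 _ DS; lra.
apply: (@le_trans _ _ (2 / g ^+ 2 * (c * (g ^+ 2 * (2 * tau ^+ 2))))).
  rewrite ler_wpM2l//; first by rewrite divr_ge0// exprn_ge0// ltW.
  apply: le_trans up _.
  by rewrite ler_wpM2l// ler_wpM2l// exprn_ge0// ltW.
by rewrite /c le_eqVlt; apply/orP; left; apply/eqP; field; rewrite !lt0r_neq0.
Qed.

Lemma curvature_ge0 X : D X -> (0 <= Cf)%E.
Proof.
move=> DX; apply: ereal_sup_ubound; exists X, X, 1; split=> //.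
  by rewrite ltr01 lexx.
by rewrite subrr scaler0 addr0 mulmx0 mxtrace0 mulr0 !subrr mulr0.
Qed.

Lemma curvature_fin_num X : D X -> Cf \is a fin_num.
Proof.
move=> DX; rewrite ge0_fin_numE; last exact: curvature_ge0 DX.
exact: le_lt_trans curvature_le (ltry _).
Qed.

Lemma curvature_bound X S (g : R) : D X -> D S -> 0 < g <= 1 ->
  f (X + g *: (S - X)) <=
  f X + g * \tr ((gradf X)^T *m (S - X)) + g ^+ 2 / 2 * fine Cf.
Proof.
move=> DX DS /andP[g0 g1].
have : ((2 / g ^+ 2 * (f (X + g *: (S - X)) - f X
    - g * \tr ((gradf X)^T *m (S - X))))%:E <= Cf)%E.
  by apply: ereal_sup_ubound; exists X, S, g; split=> //; rewrite g0.
rewrite -(fineK (curvature_fin_num DX)) lee_fin.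
rewrite mulrAC ler_pdivrMr ?exprn_gt0//.
lra.
Qed.

(** Minimality along the segment towards [X] gives [0 <= q + g C / 2] for every
    step [g] in (0, 1]; a negative [q] contradicts this for small [g]. *)
Lemma minimizer_first_order Z X : is_minimizer D f Z -> D X ->
  0 <= \tr ((gradf Z)^T *m (X - Z)).
Proof.
move=> [DZ Zmin] DX; set q := \tr _; rewrite leNgt; apply/negP => q0.
have C0 : 0 <= fine Cf by rewrite fine_ge0// (curvature_ge0 DZ).
set C := fine Cf in C0.
(* C + 1 rather than C / 2, to divide by a positive number even if C = 0. *)
pose g := Num.min 1 (- q / (C + 1)).
have C1 : 0 < C + 1 by lra.
have g0 : 0 < g by rewrite lt_min ltr01 divr_gt0// oppr_gt0.
have g1 : g <= 1 by rewrite ge_min lexx.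
have gq : g * (C + 1) <= - q by rewrite -ler_pdivlMr// ge_min lexx orbT.
have := curvature_bound DZ DX (introT andP (conj g0 g1)).
have /Zmin : D (Z + g *: (X - Z)) by apply: segment_in_D => //; rewrite (ltW g0) g1.
rewrite -/q -/C => fZ up.
have : 0 <= g * (q + g / 2 * C) by lra.
rewrite pmulr_rge0// => q1.
nra.
Qed.

Lemma minimizer_growth Z X : is_minimizer D f Z -> D X ->
  lambda_min W / (lambda_max S0 + tau) ^+ 3 * \tr ((X - Z)^T *m (X - Z)) <=
  f X - f Z.
Proof.
move=> Zmin DX; have := minimizer_first_order Zmin DX.
have := strong_convexity Zmin.1 DX; lra.
Qed.

Section Iterates.
Variables (delta : R) (Z : 'M[R]_k) (X S : nat -> 'M[R]_k).
Hypothesis delta_ge0 : 0 <= delta.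
Hypothesis Z_min : is_minimizer D f Z.
Hypothesis X0 : D (X 0).
Hypothesis XS : forall i, X i.+1 = (1 - 2 / (i%:R + 2)) *: X i + (2 / (i%:R + 2)) *: S i.
Hypothesis S_oracle : forall i, D (S i) /\
  \tr (gradf (X i) *m S i) <= inf [set \tr (gradf (X i) *m Y) | Y in D] + delta.

Lemma step_size_gt0 i : 0 < 2 / (i%:R + 2) :> R.
Proof. by rewrite divr_gt0// ltr_wpDl. Qed.

Lemma step_size_le1 i : 2 / (i%:R + 2) <= 1 :> R.
Proof. by rewrite ler_pdivrMr ?ltr_wpDl// mul1r lerDr. Qed.

Lemma iterate_in_D i : D (X i).
Proof.
elim: i => // i IH; rewrite XS; apply: D_convex => //; last by case: (S_oracle i).
by rewrite ltW ?step_size_gt0// step_size_le1.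
Qed.

(** An infimum over a set not bounded below is 0 by convention, so comparing with
    it requires a lower bound on the linear functional; the bounded traces of [D]
    supply one. *)
Lemma oracle_le i Y : D Y -> \tr (gradf (X i) *m S i) <= \tr (gradf (X i) *m Y) + delta.
Proof.
move=> DY; apply: le_trans (S_oracle i).2 _; rewrite lerD2r.
apply: ge_inf; last by exists Y.
have Gp := gradient_psd (D_psd (iterate_in_D i)).
exists (- (\tr (- gradf (X i)) * tau)) => _ [V DV <-].
have -> : \tr (gradf (X i) *m V) = - \tr (- gradf (X i) *m V).
  by rewrite mulNmx raddfN opprK.
rewrite lerN2.
apply: le_trans (tr_mul_le (psd_trB Gp) (D_psd DV)) _.
by rewrite ler_wpM2l ?psd_tr_ge0// D_tr.
Qed.

Lemma frank_wolfe_step i :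
  f (X i.+1) - f Z <= (1 - 2 / (i%:R + 2)) * (f (X i) - f Z)
     + (2 / (i%:R + 2)) ^+ 2 / 2 * fine Cf + 2 / (i%:R + 2) * delta.
Proof.
have DX := iterate_in_D i; have [DS _] := S_oracle i.
have g0 := step_size_gt0 i; have g1 := step_size_le1 i.
have := curvature_bound DX DS (introT andP (conj g0 g1)).
have -> : X i + (2 / (i%:R + 2)) *: (S i - X i) = X i.+1.
  by rewrite XS scalerBl scale1r scalerBr addrA addrAC.
have : \tr ((gradf (X i))^T *m (Z - X i)) <= f Z - f (X i).
  have := strong_convexity DX Z_min.1.
  have := mulr_ge0 (ltW (modulus_gt0 DX)) (tr_gram_ge0 (Z - X i)).
  lra.
have := oracle_le i Z_min.1.
rewrite gradient_sym; last exact: D_psd.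
rewrite !mulmxBr !raddfB /=.
set g := 2 / _ in g0 g1 *.
set a := \tr (_ *m S i); set b := \tr (_ *m X i); set c := \tr (_ *m Z).
move=> orc cvx up.
have : g * (a - b) <= g * (f Z - f (X i) + delta) by rewrite ler_pM2l//; lra.
lra.
Qed.

Lemma frank_wolfe_rate M : (1 <= M)%N ->
  f (X M) - f Z <= 2 * fine Cf / (M%:R + 2) + delta.
Proof.
apply: (frank_wolfe_recursion (h := fun i => f (X i) - f Z)) => //.
- by rewrite fine_ge0// (curvature_ge0 X0).
- exact: frank_wolfe_step.
Qed.

End Iterates.

End ConvexDomain.

(** * Mixtures on a disjoint union *)

Section SumOfMeasurableTypes.
Context {d1 d2 : measure_display} {T1 : measurableType d1} {T2 : measurableType d2}.

Definition sum_display (d d' : measure_display) : measure_display.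
Proof. exact: d. Qed.

HB.instance Definition _ := isPointed.Build (T1 + T2)%type (inl point).

(** The finest sigma-algebra that makes both injections measurable, so that a map
    out of the sum is measurable as soon as its two restrictions are. *)
Definition sum_measurable : set (set (T1 + T2)) :=
  [set A | measurable (inl @^-1` A) /\ measurable (inr @^-1` A)].

Let sum_measurable0 : sum_measurable set0.
Proof. by split; rewrite preimage_set0. Qed.

Let sum_measurableC A : sum_measurable A -> sum_measurable (~` A).
Proof. by move=> [Al Ar]; split; rewrite preimage_setC; exact: measurableC. Qed.

Let sum_measurable_bigcup (F : (set (T1 + T2))^nat) :
  (forall i, sum_measurable (F i)) -> sum_measurable (\bigcup_i F i).
Proof.
by move=> mF; split; rewrite preimage_bigcup; apply: bigcupT_measurable => i;
  case: (mF i).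
Qed.

HB.instance Definition _ := isMeasurable.Build (sum_display d1 d2)
  (T1 + T2)%type sum_measurable0 sum_measurableC sum_measurable_bigcup.

Lemma measurable_inl : measurable_fun setT (@inl T1 T2).
Proof. by move=> _ A [mA _]; rewrite setTI. Qed.

Lemma measurable_inr : measurable_fun setT (@inr T1 T2).
Proof. by move=> _ A [_ mA]; rewrite setTI. Qed.

Lemma measurable_fun_sum d (T : measurableType d) (f : T1 + T2 -> T) :
  measurable_fun setT (f \o inl) -> measurable_fun setT (f \o inr) ->
  measurable_fun setT f.
Proof.
move=> ml mr _ A mA; rewrite setTI; split.
  by have := ml measurableT A mA; rewrite setTI comp_preimage.
by have := mr measurableT A mA; rewrite setTI comp_preimage.
Qed.

Context {R : realType} (P1 : probability T1 R) (P2 : probability T2 R).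
Variables (a b : {nonneg R}).

Definition inl_law : {measure set (T1 + T2) -> \bar R}.
Proof.
unshelve refine (pushforward P1 inl : {measure set (T1 + T2) -> \bar R}).
exact: measurable_inl.
Defined.

Definition inr_law : {measure set (T1 + T2) -> \bar R}.
Proof.
unshelve refine (pushforward P2 inr : {measure set (T1 + T2) -> \bar R}).
exact: measurable_inr.
Defined.

Definition mixture : {measure set (T1 + T2) -> \bar R} :=
  measure_add (mscale a inl_law) (mscale b inr_law).

Lemma mixtureE A : (mixture A =
  a%:num%:E * P1 (inl @^-1` A) + b%:num%:E * P2 (inr @^-1` A))%E.
Proof. exact: measure_addE. Qed.

Lemma ge0_integral_mixture (f : T1 + T2 -> \bar R) : measurable_fun setT f ->
  (forall x, 0 <= f x)%E ->
  (\int[mixture]_x f x =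
   a%:num%:E * \int[P1]_x f (inl x) + b%:num%:E * \int[P2]_x f (inr x))%E.
Proof.
move=> mf f0; rewrite ge0_integral_measure_add// !ge0_integral_mscale//.
rewrite /inl_law /inr_law /=.
rewrite (ge0_integral_pushforward measurable_inl)//.
by rewrite (ge0_integral_pushforward measurable_inr).
Qed.

Lemma integrable_mixture (f : T1 + T2 -> \bar R) :
  P1.-integrable setT (f \o inl) -> P2.-integrable setT (f \o inr) ->
  mixture.-integrable setT f.
Proof.
move=> /integrableP[ml fl] /integrableP[mr fr].
have mf : measurable_fun setT f by exact: measurable_fun_sum.
apply/integrableP; split=> //; rewrite ge0_integral_mixture//; last first.
  exact: measurableT_comp.
by rewrite lte_add_pinfty// lte_mul_pinfty.
Qed.

Lemma integral_mixture (f : T1 + T2 -> \bar R) :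
  P1.-integrable setT (f \o inl) -> P2.-integrable setT (f \o inr) ->
  fine (\int[mixture]_x f x) =
  a%:num * fine (\int[P1]_x f (inl x)) + b%:num * fine (\int[P2]_x f (inr x)).
Proof.
move=> fl fr; have mf := measurable_int _ (integrable_mixture fl fr).
have -> : (\int[P1]_x f (inl x) =
    \int[P1]_x f^\+ (inl x) - \int[P1]_x f^\- (inl x))%E.
  by rewrite (integralE P1 setT (f \o inl)) funepos_comp funeneg_comp.
have -> : (\int[P2]_x f (inr x) =
    \int[P2]_x f^\+ (inr x) - \int[P2]_x f^\- (inr x))%E.
  by rewrite (integralE P2 setT (f \o inr)) funepos_comp funeneg_comp.
rewrite integralE !ge0_integral_mixture//; last 2 first.
- exact: measurable_funeneg.
- exact: measurable_funepos.
have : (\int[P1]_x f^\+ (inl x))%E \is a fin_num.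
  by have := integrable_pos_fin_num measurableT fl; rewrite funepos_comp.
have : (\int[P1]_x f^\- (inl x))%E \is a fin_num.
  by have := integrable_neg_fin_num measurableT fl; rewrite funeneg_comp.
have : (\int[P2]_x f^\+ (inr x))%E \is a fin_num.
  by have := integrable_pos_fin_num measurableT fr; rewrite funepos_comp.
have : (\int[P2]_x f^\- (inr x))%E \is a fin_num.
  by have := integrable_neg_fin_num measurableT fr; rewrite funeneg_comp.
move=> /fineK <- /fineK <- /fineK <- /fineK <- /=.
by ring.
Qed.

Hypothesis ab1 : a%:num + b%:num = 1.

Lemma mixture_setT : mixture setT = 1%E.
Proof.
by rewrite mixtureE !preimage_setT !probability_setT !mule1 -EFinD ab1.
Qed.

Definition mixture_probability : probability (T1 + T2)%type R :=
  HB.pack_for (probability (T1 + T2)%type R) (mixture : set (T1 + T2) -> \bar R)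
    (Measure.class mixture) (Measure_isProbability.Build _ _ _ mixture mixture_setT).

End SumOfMeasurableTypes.

(** The sets whose preimage is generated by [G'] form a sigma-algebra, so that it
    suffices to look at generators. *)
Lemma preimage_generated T U (f : T -> U) (G : set (set U)) (G' : set (set T)) :
  (forall A, G A -> <<s G' >> (f @^-1` A)) ->
  forall E, <<s G >> E -> <<s G' >> (f @^-1` E).
Proof.
move=> GG' E; apply: (@smallest_sub _ _ _ [set E | <<s G' >> (f @^-1` E)]) => //.
split=> /= [|A|F FG].
- by rewrite preimage_set0; exact: sigma_algebra0.
- by rewrite setTD preimage_setC -setTD; exact: sigma_algebraCD.
- by rewrite preimage_bigcup; exact: sigma_algebra_bigcup.
Qed.

(** Here the sigma-algebra to compare with is the one of all preimages of
    measurable sets under [f]. *)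
Lemma generated_by_preimages d (T : measurableType d) U (f : U -> T) (G : set (set U)) :
  (forall A, G A -> exists2 B, measurable B & A = f @^-1` B) ->
  forall E, <<s G >> E -> exists2 B, measurable B & E = f @^-1` B.
Proof.
move=> Gf E GE; suff [B mB <-] : preimage_set_system setT f measurable E.
  by exists B => //; rewrite setTI.
move: E GE; apply: smallest_sub.
  exact/sigma_algebra_preimage/sigma_algebra_measurable.
by move=> A /Gf[B mB ->]; exists B => //; rewrite setTI.
Qed.

(** * Mixing two closed loops *)

Section MixedPolicy.
Context {R : realType} {n m : nat} {A : 'M[R]_n} {B : 'M[R]_(n, m)} {H : nat}
  {d : measure_display} {Omega : measurableType d} {P : probability Omega R}
  {w : nat -> Omega -> vec R n}.
Hypothesis mw : forall t, (t < H)%N -> measurable_fun setT (w t).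
Variables (pi1 pi2 : closed_loop A B H P w) (a b : {nonneg R}).
Hypothesis ab1 : a%:num + b%:num = 1.

(** The component in which a sample point lies is the outcome of the coin; the
    seeds take values in a sum type so that the control rule can read it. *)
Definition mix_base (u : cl_space pi1 + cl_space pi2) : Omega :=
  match u with inl o => cl_base o | inr o => cl_base o end.

Definition mix_seed (t : nat) (u : cl_space pi1 + cl_space pi2) :
    cl_seed_space pi1 + cl_seed_space pi2 :=
  match u with inl o => inl (cl_seed t o) | inr o => inr (cl_seed t o) end.

Definition mix_state (t : nat) (u : cl_space pi1 + cl_space pi2) : vec R n :=
  match u with inl o => cl_state t o | inr o => cl_state t o end.

Definition mix_input (t : nat) (u : cl_space pi1 + cl_space pi2) : vec R m :=
  match u with inl o => cl_input t o | inr o => cl_input t o end.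

Definition mix_rule (t : nat)
    (xs : t.+1.-tuple (vec R n) * (cl_seed_space pi1 + cl_seed_space pi2)) : vec R m :=
  match xs.2 with
  | inl s => cl_rule (c := pi1) (xs.1, s)
  | inr s => cl_rule (c := pi2) (xs.1, s)
  end.

Definition mix_prob := mixture_probability (cl_prob pi1) (cl_prob pi2) ab1.

Lemma mix_base_meas : measurable_fun setT mix_base.
Proof. by apply: measurable_fun_sum; exact: cl_base_meas. Qed.

Lemma mix_base_law E : measurable E -> mix_prob (mix_base @^-1` E) = P E.
Proof.
move=> mE; rewrite /mix_prob [LHS]mixtureE.
have -> : inl @^-1` (mix_base @^-1` E) = cl_base (c := pi1) @^-1` E by [].
have -> : inr @^-1` (mix_base @^-1` E) = cl_base (c := pi2) @^-1` E by [].
by rewrite !cl_base_law// -ge0_muleDl// -EFinD ab1 mul1e.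
Qed.

Lemma mix_seed_meas t : measurable_fun setT (mix_seed t).
Proof.
apply: measurable_fun_sum.
- by apply: (measurableT_comp measurable_inl); exact: cl_seed_meas.
- by apply: (measurableT_comp measurable_inr); exact: cl_seed_meas.
Qed.

(** Conditionally on the coin, independence is that of the given loops.  It
    survives mixing because an event on the future disturbances has the same
    probability in both: its law is the common one on [Omega]. *)
Lemma mix_seed_indep t : (t < H)%N ->
  indep_systems mix_prob
    (\bigcup_(s in [set s | (s < t)%N]) events_of (w s \o mix_base) `|`
     \bigcup_(s in [set s | (s <= t)%N]) events_of (mix_seed s))
    (\bigcup_(s in [set s | (t <= s < H)%N]) events_of (w s \o mix_base)).
Proof.
move=> tH E F GE GF; rewrite /mix_prob ![mixture_probability _ _ _ _]mixtureE.
rewrite !preimage_setI.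
rewrite (cl_seed_indep tH (c := pi1)); last 2 first.
- apply: preimage_generated GE => _ [[s st [C mC <-]]|[s st [C mC <-]]];
    apply: sub_gen_smallest.
  + by left; exists s => //; exists C.
  + by right; exists s => //; exists (inl @^-1` C) => //; case: mC.
- apply: preimage_generated GF => _ [s st [C mC <-]]; apply: sub_gen_smallest.
  by exists s => //; exists C.
rewrite (cl_seed_indep tH (c := pi2)); last 2 first.
- apply: preimage_generated GE => _ [[s st [C mC <-]]|[s st [C mC <-]]];
    apply: sub_gen_smallest.
  + by left; exists s => //; exists C.
  + by right; exists s => //; exists (inr @^-1` C) => //; case: mC.
- apply: preimage_generated GF => _ [s st [C mC <-]]; apply: sub_gen_smallest.
  by exists s => //; exists C.
(* Future disturbances factor through the base space. *)
have [C mC ->] : exists2 C, measurable C & F = mix_base @^-1` C.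
  apply: generated_by_preimages GF => _ [s /andP[_ sH] [C mC <-]].
  exists (w s @^-1` C) => //; rewrite -[X in measurable X]setTI.
  exact: (mw sH).
have -> : inl @^-1` (mix_base @^-1` C) = cl_base (c := pi1) @^-1` C by [].
have -> : inr @^-1` (mix_base @^-1` C) = cl_base (c := pi2) @^-1` C by [].
rewrite !cl_base_law//.
rewrite -[X in (_ = _ * X)%E]ge0_muleDl// -EFinD ab1 mul1e.
by rewrite ge0_muleDl ?mule_ge0// !muleA.
Qed.

Lemma mix_rule_meas t : measurable_fun setT (@mix_rule t).
Proof.
(* The rule is a conditional on the component of the seed, with a default value
   for the seed of the loop that was not drawn. *)
pose left (u : cl_seed_space pi1 + cl_seed_space pi2) :=
  if u is inl _ then true else false.
pose getl (u : cl_seed_space pi1 + cl_seed_space pi2) :=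
  if u is inl s then s else point.
pose getr (u : cl_seed_space pi1 + cl_seed_space pi2) :=
  if u is inr s then s else point.
have mleft : measurable_fun setT left.
  by apply: measurable_fun_sum; exact: measurable_cst.
have mgetl : measurable_fun setT getl.
  by apply: measurable_fun_sum; [exact: measurable_id|exact: measurable_cst].
have mgetr : measurable_fun setT getr.
  by apply: measurable_fun_sum; [exact: measurable_cst|exact: measurable_id].
have -> : @mix_rule t = fun xs => if left xs.2 then cl_rule (c := pi1) (xs.1, getl xs.2)
                                else cl_rule (c := pi2) (xs.1, getr xs.2).
  by apply/funext => -[xs [s|s]].
apply: measurable_fun_ifT.
- exact: measurableT_comp mleft measurable_snd.
- apply: (measurableT_comp (@cl_rule_meas _ _ _ _ _ _ _ _ _ _ pi1 t)).
  apply: measurable_fun_pair; first exact: measurable_fst.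
  exact: measurableT_comp mgetl measurable_snd.
- apply: (measurableT_comp (@cl_rule_meas _ _ _ _ _ _ _ _ _ _ pi2 t)).
  apply: measurable_fun_pair; first exact: measurable_fst.
  exact: measurableT_comp mgetr measurable_snd.
Qed.

Definition mix_loop : closed_loop A B H P w.
Proof.
refine (@ClosedLoop R n m A B H d Omega P w _ _ mix_prob mix_base
  mix_base_meas mix_base_law _ _ mix_seed mix_seed_meas mix_seed_indep
  mix_rule mix_rule_meas mix_state mix_input _ _ _).
- by case=> o; exact: cl_init.
- by move=> t [v|v]; exact: cl_dynamics.
- by move=> t [v|v] tH; rewrite /= cl_control.
Defined.

Lemma finite_covariance_mix : finite_covariance pi1 -> finite_covariance pi2 ->
  finite_covariance mix_loop.
Proof. by move=> f1 f2 i j; apply: integrable_mixture; [exact: f1|exact: f2]. Qed.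

Lemma covariance_of_mix : finite_covariance pi1 -> finite_covariance pi2 ->
  covariance_of mix_loop = a%:num *: covariance_of pi1 + b%:num *: covariance_of pi2.
Proof.
move=> f1 f2; apply/matrixP => i j; rewrite !mxE !unlock.
exact: (integral_mixture (f := fun u : cl_space mix_loop => (cl_gram u i j)%:E)
  a b (f1 i j) (f2 i j)).
Qed.

End MixedPolicy.

Lemma fine_integral_lincomb d (T : measurableType d) (R : realType)
    (mu : {measure set T -> \bar R}) (I : finType) (c : I -> R) (g : I -> T -> R) :
  (forall i, mu.-integrable setT (fun x => (g i x)%:E)) ->
  fine (\int[mu]_x (\sum_i c i * g i x)%:E) =
  \sum_i c i * fine (\int[mu]_x (g i x)%:E).
Proof.
move=> gint; have cgint i : mu.-integrable setT (fun x => ((c i)%:E * (g i x)%:E)%E).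
  exact: integrableZl.
have -> : (\int[mu]_x (\sum_i c i * g i x)%:E =
    \int[mu]_x (\sum_i (c i)%:E * (g i x)%:E))%E.
  by apply: eq_integral => x _; rewrite -sumEFin; apply: eq_bigr => i _; rewrite EFinM.
rewrite (integral_sum measurableT)// -sum_fine; last first.
  by move=> i _; exact: integrable_fin_num.
apply: eq_bigr => i _; rewrite integralZl//.
by rewrite fineM//; exact: integrable_fin_num.
Qed.

Section AttainableCovariances.
Context {R : realType} {n m : nat} {A : 'M[R]_n} {B : 'M[R]_(n, m)} {H : nat}
  {d : measure_display} {Omega : measurableType d} {P : probability Omega R}
  {w : nat -> Omega -> vec R n}.

Lemma attainable_convex (S1 S2 : 'M[R]_(n + m)) (t : R) :
  (forall s, (s < H)%N -> measurable_fun setT (w s)) -> 0 <= t <= 1 ->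
  attainable A B H P w S1 -> attainable A B H P w S2 ->
  attainable A B H P w ((1 - t) *: S1 + t *: S2).
Proof.
move=> mw /andP[t0 t1] [pi1 f1 ->] [pi2 f2 ->].
have t1' : 0 <= 1 - t by rewrite subr_ge0.
have ab1 : (NngNum t1')%:num + (NngNum t0)%:num = 1 by rewrite /= subrK.
exists (mix_loop mw pi1 pi2 ab1); first exact: finite_covariance_mix.
by rewrite covariance_of_mix.
Qed.

Lemma covariance_of_form (pi : closed_loop A B H P w) (x : 'cV[R]_(n + m)) :
  finite_covariance pi ->
  \tr (x^T *m covariance_of pi *m x) =
  fine (\int[cl_prob pi]_om (\tr (x^T *m cl_gram om *m x))%:E).
Proof.
move=> fpi.
have formE (M : 'M[R]_(n + m)) :
    \tr (x^T *m M *m x) = \sum_(p : 'I_(n + m) * 'I_(n + m)) (x p.1 0 * x p.2 0) * M p.1 p.2.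
  rewrite -(pair_bigA _ (fun i j => (x i 0 * x j 0) * M i j)) exchange_big /=.
  rewrite trace_mx11 mxE; apply: eq_bigr => j _.
  rewrite mxE big_distrl /=; apply: eq_bigr => i _; rewrite mxE; ring.
have -> : (\int[cl_prob pi]_om (\tr (x^T *m cl_gram om *m x))%:E =
    \int[cl_prob pi]_om
     (\sum_(p : 'I_(n + m) * 'I_(n + m)) (x p.1 0 * x p.2 0) * cl_gram om p.1 p.2)%:E)%E.
  by apply: eq_integral => om _; rewrite formE.
rewrite formE fine_integral_lincomb; last by move=> p; exact: fpi.
by apply: eq_bigr => p _; rewrite mxE unlock.
Qed.

Lemma covariance_of_psd (pi : closed_loop A B H P w) :
  finite_covariance pi -> psd (covariance_of pi).
Proof.
move=> fpi; split=> [|x].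
  apply/matrixP => i j; rewrite !mxE; congr fine; rewrite !unlock.
  apply: eq_integral => om _; congr EFin.
  rewrite /cl_gram !summxE; apply: eq_bigr => t _.
  by rewrite !mxE; apply: eq_bigr => l _; rewrite !mxE mulrC.
rewrite covariance_of_form// fine_ge0//; apply: integral_ge0 => om _.
rewrite lee_fin /cl_gram mulmx_sumr mulmx_suml raddf_sum /=.
by apply: sumr_ge0 => t _; exact: (psd_outer _).2.
Qed.

Lemma attainable_psd S : attainable A B H P w S -> psd S.
Proof. by move=> [pi fpi ->]; exact: covariance_of_psd. Qed.

End AttainableCovariances.

(** * The budgeted set and the convergence rates *)

Lemma eqO_near_infty (R : realType) (u v : nat -> R) (c : R) :
  (forall M : nat, (1 <= M)%N -> `|u M| <= c * `|v M|) -> u =O_\oo v.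
Proof.
move=> uv; apply/eqO_exP; exists (Num.max 1 c); first by rewrite lt_max ltr01.
near=> M; apply: (le_trans (uv M _)); first by near: M; exact: nbhs_infty_ge.
by rewrite ler_wpM2r// le_max lexx orbT.
Unshelve. all: by end_near. Qed.

Section BudgetedSet.
Context {R : realType} {n m : nat} {A : 'M[R]_n} {B : 'M[R]_(n, m)} {H : nat}
  {d : measure_display} {Omega : measurableType d} {P : probability Omega R}
  {w : nat -> Omega -> vec R n}.
Variables (W2 : 'M[R]_(n + m)) (beta : R).

Lemma budgeted_convex (X Y : 'M[R]_(n + m)) (t : R) :
  (forall s, (s < H)%N -> measurable_fun setT (w s)) -> 0 <= t <= 1 ->
  budgeted A B H P w W2 beta X -> budgeted A B H P w W2 beta Y ->
  budgeted A B H P w W2 beta ((1 - t) *: X + t *: Y).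
Proof.
move=> mw t01 [aX bX] [aY bY]; split; first exact: attainable_convex.
rewrite mulmxDr -!scalemxAr mxtraceD !mxtraceZ; case/andP: t01 => t0 t1.
have : (1 - t) * \tr (W2 *m X) <= (1 - t) * beta by rewrite ler_wpM2l// subr_ge0.
have : t * \tr (W2 *m Y) <= t * beta by rewrite ler_wpM2l.
lra.
Qed.

Lemma budgeted_tr_le (X : 'M[R]_(n + m)) : (0 < n + m)%N -> posdef W2 ->
  budgeted A B H P w W2 beta X -> \tr X <= beta / lambda_min W2.
Proof.
move=> nm W2p [/attainable_psd Xp bX].
rewrite ler_pdivlMr ?posdef_lambda_min_gt0// mulrC (le_trans _ bX)//.
exact: tr_mul_ge (psd_lambda_min nm (posdef_psd W2p)) Xp.
Qed.

End BudgetedSet.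

Theorem theorem1 (R : realType) (n m H : nat)
  (n_gt0 : (0 < n)%N) (m_gt0 : (0 < m)%N) (H_gt0 : (0 < H)%N)
  (A : 'M[R]_n) (B : 'M[R]_(n, m))
  (d : measure_display) (Omega : measurableType d) (P : probability Omega R)
  (w : nat -> Omega -> vec R n) (Sigma_w : 'M[R]_n)
  (w_iid : iid P H w) (w_moments : zero_mean_cov P H w Sigma_w)
  (W1 W2 Sigma0 : 'M[R]_(n + m)) (beta delta : R)
  (Sigma_w_pd : posdef Sigma_w)
  (W1_pd : posdef W1) (W2_pd : posdef W2) (Sigma0_pd : posdef Sigma0)
  (beta_gt0 : 0 < beta)
  (beta_gt_b0 :
     inf [set \tr (W2 *m X) | X in attainable A B H P w] < beta)
  (delta_ge0 : 0 <= delta)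
  (Sigma_star : 'M[R]_(n + m)) (Sigma S : nat -> 'M[R]_(n + m)) :
  let D := budgeted A B H P w W2 beta in
  let f := objective W1 Sigma0 in
  let gradf := objective_grad W1 Sigma0 in
  let mu := lambda_min W2 in
  let alpha := fun i : nat => 2 / (i%:R + 2) : R in
  let Cf := curvature_constant D f gradf in
  let mf := 2 * lambda_min W1 / (lambda_max Sigma0 + beta / mu) ^+ 3 in
  is_minimizer D f Sigma_star ->
  D (Sigma 0%N) ->
  (forall i, Sigma i.+1 = (1 - alpha i) *: Sigma i + alpha i *: S i) ->
  (forall i, D (S i) /\
     \tr (gradf (Sigma i) *m S i) <=
       inf [set \tr (gradf (Sigma i) *m X) | X in D] + delta) ->
  [/\ forall X, is_minimizer D f X -> X = Sigma_star,
      forall M : nat, (1 <= M)%N ->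
        f (Sigma M) - f Sigma_star <= 2 * fine Cf / (M%:R + 2) + delta,
      (Cf <= (8 * spectral_norm W1 * beta ^+ 2
              / (lambda_min Sigma0 ^+ 3 * mu ^+ 2))%:E)%E,
      forall M : nat, (1 <= M)%N ->
        frobenius (Sigma M - Sigma_star) <=
          Num.sqrt (2 / mf * (2 * fine Cf / (M%:R + 2) + delta))
    & delta = 0 ->
        ((fun M : nat => f (Sigma M) - f Sigma_star : R) =O_\oo
           (fun M : nat => M%:R^-1 : R)) /\
        ((fun M : nat => frobenius (Sigma M - Sigma_star) : R) =O_\oo
           (fun M : nat => (Num.sqrt M%:R)^-1 : R))].
Proof.
move=> D f gradf mu alpha Cf mf Zmin D0 Sstep Soracle.
have nm_gt0 : (0 < n + m)%N by rewrite addn_gt0 n_gt0.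
have mw t : (t < H)%N -> measurable_fun setT (w t) by case: w_iid => + _ _; exact.
have D_psd X : D X -> psd X by move=> [/attainable_psd].
have D_tr X : D X -> \tr X <= beta / mu by exact: budgeted_tr_le.
have D_cvx X Y (t : R) : 0 <= t <= 1 -> D X -> D Y -> D ((1 - t) *: X + t *: Y).
  exact: budgeted_convex.
have DZ := Zmin.1.
have growth X := minimizer_growth nm_gt0 W1_pd Sigma0_pd D_psd D_tr D_cvx Zmin (X := X).
have rate := frank_wolfe_rate nm_gt0 W1_pd Sigma0_pd D_psd D_tr D_cvx delta_ge0 Zmin
  D0 Sstep Soracle.
have DM := iterate_in_D D_cvx D0 Sstep Soracle.
have c_gt0 := modulus_gt0 nm_gt0 W1_pd Sigma0_pd D_psd D_tr DZ.
(* The modulus of [minimizer_growth] is mf / 2. *)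
have mfE : 2 / mf = (lambda_min W1 / (lambda_max Sigma0 + beta / mu) ^+ 3)^-1.
  by rewrite /mf -mulrA invfM mulrA divff// mul1r.
have mf_gt0 : 0 < 2 / mf by rewrite mfE invr_gt0.
have Cf_le := curvature_le nm_gt0 W1_pd Sigma0_pd D_psd D_tr D_cvx.
have Cf_ge0 : 0 <= fine Cf by rewrite fine_ge0// (curvature_ge0 W1 Sigma0 DZ).
have dist M : (1 <= M)%N ->
    \tr ((Sigma M - Sigma_star)^T *m (Sigma M - Sigma_star)) <=
    2 / mf * (2 * fine Cf / (M%:R + 2) + delta).
  move=> M1; rewrite mfE ler_pdivlMl//.
  by apply: le_trans (growth _ (DM M)) _; exact: rate.
have frob M : (1 <= M)%N -> frobenius (Sigma M - Sigma_star) <=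
          Num.sqrt (2 / mf * (2 * fine Cf / (M%:R + 2) + delta)).
  by move=> M1; rewrite ler_wsqrtr// dist.
split=> //.
- move=> X [DX Xmin]; have := growth X DX.
  have := Xmin _ DZ; rewrite -/f => fXZ cX.
  apply/eqP; rewrite -subr_eq0 -tr_gram_eq0 eq_le tr_gram_ge0 andbT.
  rewrite -(ler_pM2l c_gt0) mulr0 (le_trans cX)//; by rewrite subr_le0.
- apply: le_trans Cf_le _; rewrite lee_fin.
  have -> : 8 * spectral_norm W1 * beta ^+ 2 / (lambda_min Sigma0 ^+ 3 * mu ^+ 2)
     = 8 * spectral_norm W1 * (beta / mu) ^+ 2 / lambda_min Sigma0 ^+ 3.
    by rewrite expr_div_n invfM; ring.
  rewrite ler_wpM2r//.
    by rewrite invr_ge0 exprn_ge0// ltW// posdef_lambda_min_gt0.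
  by rewrite ler_wpM2r ?sqr_ge0// ler_wpM2r ?spectral_norm_ge0// ler_nat.
- move=> delta0; have M2 (M : nat) : (1 <= M)%N -> (M%:R + 2)^-1 <= M%:R^-1 :> R.
    by move=> M1; rewrite lef_pV2 ?posrE ?ltr0n ?ltr_wpDl// lerDl.
  split.
    apply: (@eqO_near_infty _ _ _ (2 * fine Cf)) => M M1.
    rewrite ger0_norm; last by rewrite subr_ge0; apply: Zmin.2.
    apply: le_trans (rate M M1) _; rewrite delta0 addr0 ger0_norm ?invr_ge0//.
    by rewrite ler_wpM2l ?mulr_ge0// M2.
  apply: (@eqO_near_infty _ _ _ (Num.sqrt (2 / mf * (2 * fine Cf)))) => M M1.
  rewrite !ger0_norm ?invr_ge0 ?sqrtr_ge0//.
  apply: le_trans (frob M M1) _.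
  have K0 : 0 <= 2 / mf * (2 * fine Cf) by rewrite mulr_ge0 ?(ltW mf_gt0)// mulr_ge0.
  rewrite -sqrtrV// -sqrtrM// ler_wsqrtr// delta0 addr0 mulrA.
  by rewrite ler_wpM2l ?M2.
Qed.
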